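(* Let $(W,S)$ be of type $D_{n+2}$ with $S=\{0^+,0^-,1,\dots,n\}$. For $1\leq i\leq j\leq n$ and $y=w_{ij}$, $$p_{e,w_{ij}}=p_{e,w_{ji}}=\Big(v^{\ell(y)}+v^{\ell(y)-2}+\cdots+v^{\ell(y)-2(n-j)}\Big)+\Big(v^{\ell(y)-2i}+v^{\ell(y)-2i-2}+\cdots+v^{\ell(y)-2(n-j+i)}\Big).$$
   Context: Type $D_{n+2}$ (with $n\geq2$): the Coxeter diagram is simply laced with nodes $0^+,0^-,1,\dots,n$; edges $m-(m+1)$ for $1\leq m<n$, and $0^+-1$, $0^--1$. $w_0$ is the longest element, $\ell$ the length function, $e$ the identity. Let $\widehat{\cdot}$ be the identity map on $S$ if $n$ is even, and the map swapping $0^+\leftrightarrow0^-$ and fixing the other elements if $n$ is odd. For $i,j\in S$ let $s_{ij}=i\cdots j$ be the product of simple reflections along the unique shortest path from $i$ to $j$ in the diagram, and $w_{ij}=s_{i\,\widehat\jmath}\cdot w_0$. ($w_{ij}$ is the unique element of the penultimate two-sided Kazhdan–Lusztig cell with unique left ascent $i$ and unique right ascent $j$.) Kazhdan–Lusztig polynomials: the Hecke algebra over $\mathbb Z[v,v^{-1}]$ is generated by $H_s$, $s\in S$, with the braid relations and $(H_s+v)(H_s-v^{-1})=0$; $H_w$ is the standard basis; the bar involution satisfies $\overline v=v^{-1}$, $\overline{H_s}=H_s^{-1}$. $\underline H_w$ is the unique bar-invariant element of the form $H_w+\sum_{y<w}p_{y,w}H_y$ with $p_{y,w}\in v\mathbb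 Z[v]$. *)

(* Defs.v *)
From HB Require Import structures.
From mathcomp Require Import all_boot all_order all_fingroup all_algebra.
From mathcomp Require Import boolp classical_sets.

Set Implicit Arguments.
Unset Strict Implicit.
Unset Printing Implicit Defensive.

Import GRing.Theory.
Local Open Scope ring_scope.

(* Z[v, v^-1] is realized as the subring of the fraction field of Z[v] formed
   by the fractions p / v^k. *)
Definition laurent_pred : {pred {fraction {poly int}}} :=
  fun x =>
    `[< exists (p : {poly int}) (k : nat), x * tofrac 'X ^+ k = tofrac p >].

Lemma laurentP x : reflect
  (exists (p : {poly int}) (k : nat), x * tofrac 'X ^+ k = tofrac p)
  (x \in laurent_pred).
Proof. exact: asboolP. Qed.

Fact laurent_subring_closed : subring_closed laurent_pred.
Proof.
split.
- by apply/laurentP; exists 1, 0%N; rewrite expr0 mulr1 rmorph1.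
- move=> x y /laurentP[p [k xE]] /laurentP[q [l yE]]; apply/laurentP.
  exists (p * 'X^l - q * 'X^k), (k + l)%N.
  by rewrite rmorphB !rmorphM /= !rmorphXn /= -xE -yE exprD mulrBl
     !mulrA (mulrAC y).
- move=> x y /laurentP[p [k xE]] /laurentP[q [l yE]]; apply/laurentP.
  by exists (p * q), (k + l)%N; rewrite rmorphM /= -xE -yE exprD mulrACA.
Qed.

HB.instance Definition _ :=
  GRing.isSubringClosed.Build {fraction {poly int}} laurent_pred
    laurent_subring_closed.

Record laurent : Type :=
  Laurent { laurent_val : {fraction {poly int}}; _ : laurent_val \in laurent_pred }.

HB.instance Definition _ := [isSub for laurent_val].
HB.instance Definition _ := [Choice of laurent by <:].
HB.instance Definition _ := [SubChoice_isSubComNzRing of laurent by <:].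

Fact laurent_of_poly_subproof (p : {poly int}) : tofrac p \in laurent_pred.
Proof. by apply/laurentP; exists p, 0%N; rewrite expr0 mulr1. Qed.

Definition laurent_of_poly (p : {poly int}) : laurent :=
  Laurent (laurent_of_poly_subproof p).

Fact laurent_vinv_subproof : (tofrac ('X : {poly int}))^-1 \in laurent_pred.
Proof.
apply/laurentP; exists 1, 1%N.
by rewrite expr1 rmorph1 mulVf // tofrac_eq0 polyX_eq0.
Qed.

Definition lv : laurent := laurent_of_poly 'X.
Definition lvinv : laurent := Laurent laurent_vinv_subproof.

Lemma lv_vinv : lv * lvinv = 1.
Proof. by apply: val_inj; rewrite /= mulfV // tofrac_eq0 polyX_eq0. Qed.

Definition coxeter_relations (S : finType) (m : S -> S -> nat) (G : groupType)
    (f : S -> G) : Prop :=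
  forall s t, ((f s * f t) ^+ m s t = 1)%g.

(* The group presented by the Coxeter matrix m, given by its universal property
   among all (possibly infinite) groups.  The carrier is a finGroupType, which
   restricts m to the Coxeter matrices of finite type. *)
Record coxeter_system (S : finType) (m : S -> S -> nat) := CoxeterSystem {
  cox_group :> finGroupType;
  cox_gen : S -> cox_group;
  cox_generated : <<[set cox_gen s | s : S]>>%g = [set: cox_group];
  cox_rel : coxeter_relations m cox_gen;
  cox_univ : forall (G : groupType) (f : S -> G), coxeter_relations m f ->
    exists phi : {multiplicative cox_group -> G},
      forall s, phi (cox_gen s) = f s
}.

Section CoxeterSystem.
Variables (S : finType) (m : S -> S -> nat) (W : coxeter_system m).
Implicit Types (w x y : W) (u : seq S).

Definition word_prod u : W := (\prod_(s <- u) cox_gen W s)%g.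

Definition has_word w (k : nat) : bool :=
  [exists u : k.-tuple S, word_prod u == w].

Fact ex_has_word w : exists k, has_word w k.
Proof.
have : w \in <<[set cox_gen W s | s : S]>>%g by rewrite cox_generated inE.
case/gen_prodgP=> k [c cS ->]; exists k.
have cE i : exists s, cox_gen W s == c i.
  by case/imsetP: (cS i) => s _ ->; exists s.
apply/existsP; exists [tuple xchoose (cE i) | i < k].
rewrite /word_prod big_tuple; apply/eqP/eq_bigr => i _.
by rewrite tnth_mktuple (eqP (xchooseP (cE i))).
Qed.

Definition cox_length w : nat := ex_minn (ex_has_word w).

Fact ex_reduced_word w :
  exists u : (cox_length w).-tuple S, word_prod u == w.
Proof. by rewrite /cox_length; case: ex_minnP => k /existsP. Qed.

Definition reduced_word w : seq S := xchoose (ex_reduced_word w).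

Definition longest : W := [arg max_(w > 1%g : W) cox_length w]%N.

Definition is_reflection w : bool :=
  [exists s, exists z : W, w == conjg (cox_gen W s) z].

Definition bruhat_step x y : bool :=
  (cox_length x < cox_length y)%N &&
  [exists t : W, is_reflection t && (y == x * t)%g].

Definition bruhat_le x y : bool := connect bruhat_step x y.
Definition bruhat_lt x y : bool := (x != y) && bruhat_le x y.

End CoxeterSystem.

Section HeckeAlgebra.
Variables (S : finType) (m : S -> S -> nat).

Definition alternating (T : Type) (s t : T) (k : nat) : seq T :=
  mkseq (fun i => if odd i then t else s) k.

Definition hecke_relations (A : algType laurent) (f : S -> A) : Prop :=
  (forall s t, \prod_(r <- alternating s t (m s t)) f r =
               \prod_(r <- alternating t s (m s t)) f r) /\
  (forall s, (f s + lv%:A) * (f s - lvinv%:A) = 0).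

(* The Z[v, v^-1]-algebra presented by the braid and quadratic relations, given
   by its universal property. *)
Record hecke_algebra := HeckeAlgebra {
  hecke_alg :> algType laurent;
  hecke_gen : S -> hecke_alg;
  hecke_rel : hecke_relations hecke_gen;
  hecke_univ : forall (A : algType laurent) (f : S -> A), hecke_relations f ->
    exists phi : {lrmorphism hecke_alg -> A},
      (forall s, phi (hecke_gen s) = f s) /\
      (forall psi : {lrmorphism hecke_alg -> A},
         (forall s, psi (hecke_gen s) = f s) -> psi =1 phi)
}.

(* These values determine the ring endomorphism bar, since v, v^-1 and the H_s
   generate H as a ring. *)
Definition is_bar (H : hecke_algebra) (bar : {rmorphism H -> H}) : Prop :=
  bar lv%:A = lvinv%:A /\
  forall s, bar (hecke_gen H s) * hecke_gen H s = 1 /\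
            hecke_gen H s * bar (hecke_gen H s) = 1.

Variables (W : coxeter_system m) (H : hecke_algebra) (bar : {rmorphism H -> H}).

(* Independent of the chosen reduced word, by the braid relations. *)
Definition std_basis (w : W) : H := \prod_(s <- reduced_word w) hecke_gen H s.

(* [is_KL w p] says that the p y, for y : W, are the coefficients of the
   Kazhdan-Lusztig basis element of w, as polynomials in v: the condition that
   p y has no constant term says that p y is in v Z[v]. *)
Definition is_KL (w : W) (p : {ffun W -> {poly int}}) : Prop :=
  [/\ p w = 1,
      forall y, bruhat_lt y w -> (p y)`_0 = 0,
      forall y, ~~ bruhat_le y w -> p y = 0 &
      let C := std_basis w +
        \sum_(y | bruhat_lt y w) laurent_of_poly (p y) *: std_basis y in
      bar C = C].

(* The Kazhdan-Lusztig polynomial p_{y,w}, using the existence and uniqueness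
   of the Kazhdan-Lusztig basis. *)
Definition KL_poly (y w : W) : {poly int} := xget [ffun=> 0] (is_KL w) y.

End HeckeAlgebra.

(* The node 0^- is None, the node 0^+ is Some 0, and the node k is Some k for
   1 <= k <= n. *)
Definition nodeD (n : nat) : finType := option 'I_n.+1.

Definition adjD (n : nat) : rel (nodeD n) := fun x y =>
  match x, y with
  | Some a, Some b => (a.+1 == b :> nat) || (b.+1 == a :> nat)
  | Some a, None | None, Some a => a == 1%N :> nat
  | None, None => false
  end.

Definition coxD (n : nat) (x y : nodeD n) : nat :=
  if x == y then 1%N else if adjD x y then 3%N else 2%N.

Definition hatD (n : nat) (x : nodeD n) : nodeD n :=
  if odd n then tperm (None : nodeD n) (Some ord0) x else x.

Definition is_shortest_path (T : eqType) (e : rel T) (x y : T) (p : seq T) :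
    Prop :=
  [/\ path e x p, last x p = y &
      forall q, path e x q -> last x q = y -> (size p <= size q)%N].

(* As for [path], the start node is left out: the unique shortest path from x
   to y is x :: geodesicD x y. *)
Definition geodesicD (n : nat) (x y : nodeD n) : seq (nodeD n) :=
  xget [::] (is_shortest_path (@adjD n) x y).

Definition s_D (n : nat) (W : coxeter_system (@coxD n)) (x y : nodeD n) : W :=
  word_prod W (x :: geodesicD x y).

Definition w_D (n : nat) (W : coxeter_system (@coxD n)) (x y : nodeD n) : W :=
  (s_D W x (hatD y) * longest W)%g.

(* Main.v *)
From HB Require Import structures.
Require Import Defs.
From mathcomp Require Import all_boot all_order all_fingroup all_algebra.
From mathcomp Require Import boolp classical_sets.
From mathcomp Require Import zify ring.

Set Implicit Arguments.
Unset Strict Implicit.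
Unset Printing Implicit Defensive.

Import Order.TTheory GRing.Theory Num.Theory.

(** Write C_w for the Kazhdan-Lusztig element of w and C_s = H_s + v.  The proof
    reaches w_ij from a parabolic subgroup by steps x -> x s, and keeps track of
    the coefficient at 1 of C_(x s) in terms of those of the elements before.

    If s is an ascent of x then C_x C_s is the sum of C_(x s) and of the
    mu(y,x) C_y, where y < x has the descent s and mu(y,x) is the coefficient of v
    in p_(y,x).  If s is the only ascent of x, then such a y has an ascent t that
    is a descent of x, and p_(y,x) = v p_(y t,x) forces y = x t: the correction is
    the sum of the C_(x t) over the descents t of x for which s is a descent of
    x t ([KL_step], [KL_chain_step]).  Such t are found by the action on weights: a
    positive coordinate at s of a dominant weight moved by w shows that s is an
    ascent of w ([asc_wact]).  Along a chain with one ascent at a time, the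
    correction is the preceding element of the chain, and the braid relation for
    the C_s shows that the new element is invariant under all generators but the
    next one ([rinv_braid]).

    The first chain starts with the longest element w_J of the parabolic subgroup
    of J = S \ {n}, for which C_(w_J) is the sum of the v^(l(w_J) - l(y)) H_y
    ([KL_parabolic]).  It follows the weights in the orbit of the fundamental
    weight of n, that is, the vector representation: from w_J multiply by
    n, ..., 1, then by 0^+ and 0^-, where the chain forks and closes again, and
    then by 1, ..., n.  It ends with w_0, so that the elements after the fork are
    the w_0 n ... k = w_nk ([end_row]).  The anti-automorphism H_w -> H_(w^-1)
    passes to w_kn = k ... n w_0 ([KL_coefsV]), and for k = i a second chain,
    which multiplies by n, ..., j + 1, ends with w_ij ([row_KL]).

    All these elements keep the left descents of their starting point.  If the
    letter s of a step is a left descent then p_1 = v p_s, and the coefficients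
    f_d at 1 along the chain satisfy

      v f_(d+1) = (v^2 + 1) f_d - v f_(d-1)

    ([KLp1_step]).  The first letter n of the first chain is not in J, hence not in
    the support of C_(w_J), and multiplies f by v only; the recursion then gives
    v^l for the elements of length l as far as the fork.  Where the fork closes
    nothing is subtracted, in the next step both of its arms are, and the result
    is v^(L+k) + v^(L-k) for w_nk.  The second chain, which starts with f_(-1) = 0,
    sums up these powers to two sequences with exponents that differ by 2
    ([ladder]).

    The Hecke algebra is given by a presentation.  Its regular representation on
    the formal span of W shows that the H_w are independent ([lin_inj]); with the
    triangularity of the bar involution ([bar_std]), the four conditions on
    Kazhdan-Lusztig coefficients have one solution at most ([KL_coefs_uniq]), so
    the solutions built along the chains are the polynomials p_(y,w). *)

(** * Coxeter groups: reflections, Bruhat order, longest element *)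

Section CoxeterGroups.
Local Open Scope group_scope.
Variables (S : finType) (m : S -> S -> nat).
Hypothesis m_diag : forall s, m s s = 1%N.
Variable W : coxeter_system m.
Implicit Types (s : S) (w x y t : W) (u : seq S).

Local Notation g := (cox_gen W).
Local Notation len := (@cox_length S m W).
Local Notation word := (word_prod W).

Lemma gen_mul s : g s * g s = 1.
Proof. by have := @cox_rel _ _ W s s; rewrite m_diag expg1. Qed.

Lemma cox_genV s : (g s)^-1 = g s.
Proof. by apply: (mulgI (g s)); rewrite mulgV gen_mul. Qed.

Lemma genK w s : w * g s * g s = w.
Proof. by rewrite -mulgA gen_mul mulg1. Qed.

Lemma genKl w s : g s * (g s * w) = w.
Proof. by rewrite mulgA gen_mul mul1g. Qed.

Lemma conj_gen x s : x ^ g s = g s * x * g s.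
Proof. by rewrite /conjg cox_genV mulgA. Qed.

Lemma word_nil : word [::] = 1. Proof. by rewrite /word_prod big_nil. Qed.

Lemma word_cons s u : word (s :: u) = g s * word u.
Proof. by rewrite /word_prod big_cons. Qed.

Lemma word_rcons u s : word (rcons u s) = word u * g s.
Proof. by rewrite /word_prod big_rcons. Qed.

Lemma word_cat u1 u2 : word (u1 ++ u2) = word u1 * word u2.
Proof. by rewrite /word_prod big_cat. Qed.

Lemma word_rev u : word (rev u) = (word u)^-1.
Proof.
elim: u => [|s u IH]; first by rewrite word_nil invg1.
by rewrite rev_cons word_rcons IH word_cons invMg cox_genV.
Qed.

(** ** Length *)

Lemma length_word u : (len (word u) <= size u)%N.
Proof.
rewrite /cox_length; case: ex_minnP => k _; apply.
by apply/existsP; exists (in_tuple u).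
Qed.

Lemma reduced_wordE w : word (reduced_word w) = w.
Proof. exact: (eqP (xchooseP (ex_reduced_word w))). Qed.

Lemma size_reduced_word w : size (reduced_word w) = len w.
Proof. by rewrite /reduced_word size_tuple. Qed.

Lemma length1 : len 1 = 0%N.
Proof. by apply/eqP; rewrite -leqn0 -word_nil; apply: length_word. Qed.

Lemma lengthV w : len w^-1 = len w.
Proof.
have le x : (len x^-1 <= len x)%N.
  rewrite -{1}(reduced_wordE x) -word_rev -(size_reduced_word x).
  by rewrite -size_rev length_word.
by apply/eqP; rewrite eqn_leq le -{1}(invgK w) le.
Qed.

Lemma length_mulr w s : (len (w * g s) <= (len w).+1)%N.
Proof.
rewrite -{1}(reduced_wordE w) -word_rcons -(size_reduced_word w).
by rewrite -(size_rcons _ s) length_word.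
Qed.

Lemma length_mul_gen w s : (len w <= (len (w * g s)).+1)%N.
Proof. by rewrite -{1}(genK w s) length_mulr. Qed.

(** ** Reflections *)

(** With W in place of its set of reflections, these pairs stand for the roots:
    g s changes the sign of its own root only. *)
Definition refl_act s (x : W * bool) : W * bool := (x.1 ^ g s, (x.1 == g s) (+) x.2).

Lemma refl_act_inv s : involutive (refl_act s).
Proof.
case=> t b; rewrite /refl_act /= -conjgM gen_mul conjg1.
have -> : (t ^ g s == g s) = (t == g s).
  by rewrite -[RHS](inj_eq (conjg_inj (g s))) /conjg mulKg.
by rewrite addbA addbb.
Qed.

Definition refl_perm s : {perm (W * bool)} := perm (inv_inj (refl_act_inv s)).

Lemma refl_perm_pow s r k x b :
  ((refl_perm s * refl_perm r) ^+ k) (x, b) =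
  (x ^ ((g s * g r) ^+ k),
   odd (count (fun i => x == (g s * g r) ^+ i * g s) (iota 0 k.*2)) (+) b).
Proof.
set c := g s * g r.
have sVc : g s * c^-1 = c * g s by rewrite /c invMg !cox_genV mulgA.
have sVck j : g s * c ^- j = c ^+ j * g s.
  elim: j => [|j IH]; first by rewrite expg0 invg1 mulg1 mul1g.
  by rewrite {1}expgS invMg mulgA IH -mulgA sVc mulgA -expgSr.
have eqJ y j : (x ^ (c ^+ j) == y) = (x == c ^+ j * (y * c ^- j)).
  by rewrite -(inj_eq (conjg_inj (c ^+ j)^-1)) conjgK /conjg invgK.
elim: k => [|k IH]; first by rewrite expg0 perm1 conjg1.
have -> : (k.+1).*2 = (k.*2 + 2)%N by rewrite doubleS addn2.
rewrite expgSr permM IH permM !permE iotaD count_cat oddD /refl_act /=.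
rewrite !add0n !oddD !oddb -!conjgM -/c -expgSr; congr pair.
have -> : (x ^ (c ^+ k) == g s) = (x == c ^+ k.*2 * g s).
  by rewrite eqJ sVck mulgA -expgD addnn.
have -> : (x ^ (c ^+ k * g s) == g r) = (x == c ^+ (k.*2).+1 * g s).
  rewrite conjgM -(inj_eq (conjg_inj (g s))) -!conjgM gen_mul mulg1.
  rewrite conj_gen -/c eqJ -mulgA sVck !mulgA.
  rewrite -[c ^+ k * g s * g r]mulgA -/c -expgSr.
  by rewrite -expgD addSn addnn.
case: (x == c ^+ k.*2 * g s); case: (x == c ^+ k.*2.+1 * g s);
  by case: odd; case: (b).
Qed.

Lemma refl_perm_rel : coxeter_relations m refl_perm.
Proof.
move=> s r; apply/permP=> -[x b]; rewrite perm1 refl_perm_pow.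
have c1 := @cox_rel _ _ W s r; rewrite c1 conjg1; congr pair.
have shift k : iota k k = [seq (k + i)%N | i <- iota 0 k] by rewrite -iotaDl addn0.
rewrite -addnn iotaD count_cat add0n shift count_map.
set n1 := count _ _; set n2 := count _ _.
suff -> : n2 = n1 by rewrite oddD addbb.
by apply: eq_count => i /=; rewrite expgD c1 mul1g.
Qed.

(** By refl_perm_rel a word acts on the pairs through its product.  So the parity
    with which t occurs among the inversions of a word is a function r w t of the
    product w of the word. *)
Lemma reflection_cocycle : exists r : W -> W -> bool,
  [/\ forall t, r 1 t = false,
      forall w s t, r (w * g s) t = (t == g s) (+) r w (t ^ g s) &
      forall w x t, r (w * x) t = r x t (+) r w (t ^ x^-1)].
Proof.
have [phi phiE] := cox_univ W refl_perm_rel.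
have phi1 : phi 1 = 1 by apply: (mulgI (phi 1)); rewrite -gmulfM !mulg1.
exists (fun w t => (phi w^-1 (t, false)).2).
have act u x b : (phi (word u) (x, b)) =
    (x ^ word u, b (+) (phi (word u) (x, false)).2).
  elim: u x b => [|s u IH] x b.
    by rewrite word_nil phi1 !perm1 conjg1 addbF.
  rewrite word_cons gmulfM !permM !phiE !permE /refl_act /= IH conjgM.
  by rewrite [in RHS]IH /= addbF !addbA [_ (+) b]addbC.
have actE w x b : phi w (x, b) = (x ^ w, b (+) (phi w (x, false)).2).
  by rewrite -(reduced_wordE w) act.
split=> [t|w s t|w x t].
- by rewrite invg1 phi1 perm1.
- by rewrite invMg cox_genV gmulfM permM phiE permE /refl_act /= actE addbF.
- by rewrite invMg gmulfM permM actE /= actE.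
Qed.

Lemma is_reflectionJ t x : is_reflection t -> is_reflection (t ^ x).
Proof.
case/existsP=> s /existsP[z /eqP->]; apply/existsP; exists s.
by apply/existsP; exists (z * x); rewrite conjgM.
Qed.

Lemma is_reflection_gen s : is_reflection (g s).
Proof. by apply/existsP; exists s; apply/existsP; exists 1; rewrite conjg1. Qed.

Lemma reflection_inv t : is_reflection t -> t * t = 1.
Proof.
by case/existsP=> s /existsP[z /eqP->]; rewrite -conjMg gen_mul conj1g.
Qed.

Lemma cocycle_deletion r : (forall t, r 1 t = false) ->
  (forall w s t, r (w * g s) t = (t == g s) (+) r w (t ^ g s)) ->
  forall u t, r (word u) t ->
  exists u1 s u2, u = u1 ++ s :: u2 /\ word u * t = word (u1 ++ u2).
Proof.
move=> r1 rS; elim/last_ind=> [|u s IH] t; first by rewrite word_nil r1.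
rewrite word_rcons rS; have [-> _|/= _ /IH[u1 [q [u2 [uE prodE]]]]] := eqVneq.
  by exists u, s, [::]; rewrite cats1 cats0 genK.
exists u1, q, (rcons u2 s); rewrite -rcons_cons -!rcons_cat -uE; split=> //.
by rewrite word_rcons -prodE conj_gen !mulgA genK.
Qed.

(** If r w t holds then t is an inversion of every word for w, and deleting the
    corresponding letter gives w t, which is shorter.  Otherwise r (w t) t holds,
    as r t t does, and w is shorter than w t. *)
Lemma length_cocycle : exists r : W -> W -> bool,
  [/\ forall w s t, r (w * g s) t = (t == g s) (+) r w (t ^ g s),
      forall w s t, r (g s * w) t = (g s * w == w * t) (+) r w t,
      forall u t, r (word u) t ->
        exists u1 s u2, u = u1 ++ s :: u2 /\ word u * t = word (u1 ++ u2) &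
      forall w t, is_reflection t ->
        if r w t then (len (w * t) < len w)%N else (len w < len (w * t))%N].
Proof.
have [r [r1 rS rM]] := reflection_cocycle.
have del := cocycle_deletion r1 rS; exists r; split=> //.
  move=> w s t; rewrite rM -(mul1g (g s)) rS r1 addbF addbC mul1g eq_sym.
  by rewrite -(inj_eq (mulIg w)) -conjgCV.
have lt w t : r w t -> (len (w * t) < len w)%N.
  rewrite -(reduced_wordE w) => /del[u1 [s [u2 [uE ->]]]].
  rewrite (leq_ltn_trans (length_word _)) // reduced_wordE -size_reduced_word.
  by rewrite uE !size_cat /= addnS.
have rt y : is_reflection y -> r y y.
  case/existsP=> s /existsP[z /eqP->].
  set t := g s ^ z.
  have tz : t ^ z^-1 = g s by rewrite conjgK.
  have rs : r (g s) (g s) by rewrite -(mul1g (g s)) rS mul1g eqxx r1.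
  have r0 : r z t (+) r z^-1 (g s) = false by rewrite -tz -rM mulVg r1.
  have -> : r t t = r (z^-1 * (g s * z)) t by [].
  rewrite rM rM tz rs invMg cox_genV conjgM tz conj_gen gen_mul mul1g.
  by rewrite addbAC r0.
move=> w t tr; case: ifP => [/lt //|/negbT rwt].
rewrite -{1}(mulg1 w) -(reflection_inv tr) mulgA; apply: lt.
by rewrite rM rt // /conjg invgK mulgV mulg1.
Qed.

(** ** Descents *)

Definition desc w s := (len (w * g s) < len w)%N.

Lemma reflection_length_neq w t : is_reflection t -> len (w * t) != len w.
Proof.
have [r [_ _ _ /[apply] /(_ w)]] := length_cocycle.
by case: ifP => _; [move/ltn_eqF->|rewrite eq_sym => /ltn_eqF->].
Qed.

Lemma descP w s : if desc w s then len w = (len (w * g s)).+1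
                  else len (w * g s) = (len w).+1.
Proof.
have := reflection_length_neq w (is_reflection_gen s).
have := length_mulr w s; have := length_mul_gen w s.
by rewrite /desc; case: ifP; lia.
Qed.

Lemma length_desc w s : desc w s -> len w = (len (w * g s)).+1.
Proof. by move=> ws; have := descP w s; rewrite ws. Qed.

Lemma length_asc w s : ~~ desc w s -> len (w * g s) = (len w).+1.
Proof. by move=> ws; have := descP w s; rewrite (negPf ws). Qed.

Lemma desc_mul w s : desc (w * g s) s = ~~ desc w s.
Proof. by have := descP w s; rewrite /desc genK; case: ifP; lia. Qed.

Lemma desc_reflection w s t : is_reflection t ->
  (len (w * g s * t) < len (w * g s))%N =
  (t == g s) (+) (len (w * t ^ g s) < len w)%N.
Proof.
have [r [rS _ _ rN]] := length_cocycle; move=> tr.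
have rE x y : is_reflection y -> (len (x * y) < len x)%N = r x y.
  move=> yr; have := rN x y yr.
  by case: ifP => // _ lt_l; rewrite ltnNge (ltnW lt_l).
by rewrite !rE // ?rS //; apply: is_reflectionJ.
Qed.

(** By the cocycle, the inversions of w and of s w differ at w^-1 s w only. *)
Lemma desc_mull w s r : g s * w != w * g r -> desc (g s * w) r = desc w r.
Proof.
have [f [_ fM _ fN]] := length_cocycle; move=> neq.
have fE x q : desc x q = f x (g q).
  have := fN x _ (is_reflection_gen q).
  by rewrite /desc; case: ifP => // _ lt_l; rewrite ltnNge (ltnW lt_l).
by rewrite !fE fM (negPf neq).
Qed.

(** The strong exchange condition. *)
Lemma deletion u t : is_reflection t -> (len (word u * t) < len (word u))%N ->
  exists u1 s u2, u = u1 ++ s :: u2 /\ word u * t = word (u1 ++ u2).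
Proof.
have [r [_ _ del rN]] := length_cocycle; move=> tr.
have := rN (word u) t tr; by case: ifP => [/del // | _ /ltnW]; rewrite leqNgt => /negPf->.
Qed.

Lemma reduced_subword (J : pred S) u : all J u ->
  exists u', [/\ all J u', word u' = word u & size u' = len (word u)].
Proof.
elim/last_ind: u => [|u s IH]; first by exists [::]; rewrite word_nil length1.
rewrite all_rcons word_rcons => /andP[Js /IH[u' [Ju' <- szu']]].
have [ds|/length_asc ds] := boolP (desc (word u') s).
  have [u1 [q [u2 [uE wE]]]] := deletion (is_reflection_gen s) ds.
  exists (u1 ++ u2); split=> //.
    by move: Ju'; rewrite uE !all_cat /= => /and3P[-> _ ->].
  by apply/eqP; rewrite -eqSS -(length_desc ds) -szu' uE !size_cat addnS.
exists (rcons u' s); rewrite all_rcons Js Ju' word_rcons size_rcons szu'.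
by rewrite ds.
Qed.

(** ** Bruhat order *)

Local Notation le := (@bruhat_le S m W).

Lemma bruhat_refl w : le w w. Proof. exact: connect0. Qed.

Lemma bruhat_trans w x y : le w x -> le x y -> le w y.
Proof. exact: connect_trans. Qed.

Lemma bruhat_desc w s : desc w s -> le (w * g s) w.
Proof.
move=> ws; apply: connect1; rewrite /bruhat_step -/(desc w s) ws /=.
by apply/existsP; exists (g s); rewrite is_reflection_gen genK /=.
Qed.

Lemma bruhat_asc w s : ~~ desc w s -> le w (w * g s).
Proof. by rewrite -desc_mul => /bruhat_desc; rewrite genK. Qed.

Lemma bruhat_length x y : le x y -> x = y \/ (len x < len y)%N.
Proof.
case/connectP=> p; elim: p x => [|z p IH] x /=; first by left.
case/andP=> /andP[lt_xz _] /IH{}IH /IH[<-|]; first by right.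
by move/(ltn_trans lt_xz); right.
Qed.

Lemma bruhat_length_le x y : le x y -> (len x <= len y)%N.
Proof. by case/bruhat_length=> [->|/ltnW]. Qed.

(** Multiply a chain of reflections from x to w by s on the right.  A step from x
    to x t is still a step after the multiplication, unless t = s; and then x s is
    the next element of the chain itself. *)
Lemma bruhat_lift x w s : le x w -> le (x * g s) w \/ le (x * g s) (w * g s).
Proof.
case/connectP=> p; elim: p x => [|y p IH] x /=.
  by move=> _ ->; right; apply: bruhat_refl.
case/andP=> /andP[lt_xy /existsP[t /andP[tr /eqP yE]]] pyp wE.
have tr' := is_reflectionJ (g s) tr.
have ysE : y * g s = x * g s * (t ^ g s) by rewrite yE conj_gen !mulgA genK.
have [lt_s|] := ltnP (len (x * g s)) (len (y * g s)).
  have le_s : le (x * g s) (y * g s).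
    apply: connect1; rewrite /bruhat_step lt_s /=.
    by apply/existsP; exists (t ^ g s); rewrite tr' ysE /=.
  by case: (IH _ pyp wE) => [|] /(bruhat_trans le_s); [left|right].
have := reflection_length_neq (x * g s) tr'; rewrite -ysE => neq ge_s.
have {neq ge_s}lt_s : (len (y * g s) < len (x * g s))%N by rewrite ltn_neqAle neq.
suff -> : x * g s = y.
  by left; apply/connectP; exists p.
have := desc_reflection (y * g s) s tr; rewrite genK.
have xE : y * t = x by rewrite yE -mulgA reflection_inv ?mulg1.
have -> : y * g s * t ^ g s = x * g s by rewrite conj_gen !mulgA genK xE.
rewrite xE lt_xy [(len (x * _) < _)%N]ltnNge (ltnW lt_s) addbF => /esym/eqP tE.
by rewrite yE tE.
Qed.

Lemma bruhatV x y : le x y -> le x^-1 y^-1.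
Proof.
case/connectP=> p; elim: p x => [|z p IH] x /=.
  by move=> _ ->; apply: bruhat_refl.
case/andP=> /andP[lt_xz /existsP[t /andP[tr /eqP zE]]] pzp yE.
apply: bruhat_trans (IH _ pzp yE); apply: connect1.
rewrite /bruhat_step !lengthV lt_xz; apply/existsP; exists (t ^ x^-1).
rewrite is_reflectionJ // zE invMg /conjg invgK !mulgA mulVg mul1g /=.
by rewrite -(mulg1 t^-1) -(reflection_inv tr) mulgA mulVg mul1g.
Qed.

Lemma bruhat_lift_asc x w s : le x w -> ~~ desc w s -> le (x * g s) (w * g s).
Proof.
by move=> /(bruhat_lift s)[] // /bruhat_trans le_xw /bruhat_asc; apply: le_xw.
Qed.

Lemma bruhat_lift_desc x w s : le x w -> desc w s -> le (x * g s) w.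
Proof.
by move=> /(bruhat_lift s)[] // /bruhat_trans le_xw /bruhat_desc; apply: le_xw.
Qed.

Lemma exists_desc w : w != 1 -> exists s, desc w s.
Proof.
move=> w1; have: reduced_word w != [::].
  by apply: contraNneq w1 => w0; rewrite -(reduced_wordE w) w0 word_nil.
have wE := reduced_wordE w; have szw := size_reduced_word w.
case/lastP: (reduced_word w) wE szw => // u s; rewrite word_rcons size_rcons.
move=> wE szw _; exists s; rewrite /desc -{1}wE genK -szw ltnS.
exact: length_word.
Qed.

Lemma bruhat_1 w : le 1 w.
Proof.
have [k] := ubnP (len w); elim: k w => // k IH w lw.
have [->|/exists_desc[s ws]] := eqVneq w 1; first exact: bruhat_refl.
apply: bruhat_trans (bruhat_desc ws); apply: IH.
by have := length_desc ws; lia.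
Qed.

(** By the lifting property, the letters of J can be appended one by one without
    leaving the interval below w. *)
Lemma bruhat_parabolic (J : pred S) w u :
  (forall s, J s -> desc w s) -> all J u -> le (word u) w.
Proof.
move=> wJ; elim/last_ind: u => [|u s IH]; first by rewrite word_nil bruhat_1.
rewrite all_rcons word_rcons => /andP[Js /IH le_uw].
exact: bruhat_lift_desc le_uw (wJ _ Js).
Qed.

(** ** The longest element *)

Local Notation w0 := (longest W).

Lemma length_longest w : (len w <= len w0)%N.
Proof. by rewrite /longest; case: arg_maxnP => // x _; apply. Qed.

Lemma desc_longest s : desc w0 s.
Proof.
apply: contraT => /length_asc; have := length_longest (w0 * g s); lia.
Qed.

Lemma longest_uniq w : (forall s, desc w s) -> w = w0.
Proof.
move=> dw; have /bruhat_length[->//|] : le w0 w.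
  by rewrite -(reduced_wordE w0) (@bruhat_parabolic predT) // all_predT.
by rewrite ltnNge length_longest.
Qed.

Lemma length_longest_uniq w : len w = len w0 -> w = w0.
Proof.
move=> lw; apply: longest_uniq => s; apply: contraT => /length_asc.
by have := length_longest (w * g s); lia.
Qed.

Lemma longestV : w0^-1 = w0.
Proof. by apply: length_longest_uniq; rewrite lengthV. Qed.

End CoxeterGroups.

(** * The group of bijections of a type *)

(** Coxeter systems are universal among all groups, so W acts on an infinite set
    as soon as its generators do.  Products are read from left to right. *)
Record bijection (T : Type) := Bijection {
  bij_fun :> T -> T;
  bij_inv : T -> T;
  bij_funK : cancel bij_fun bij_inv;
  bij_invK : cancel bij_inv bij_fun
}.

Section BijectionGroup.
Variable T : Type.
Implicit Types f g : bijection T.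

Lemma bijection_eq f g : (forall x, f x = g x) -> f = g.
Proof.
case: f g => [f f' fK f'K] [g g' gK g'K] /= /funext fg.
case: g / fg gK g'K => gK g'K.
have f'g' : f' = g' by apply/funext=> x; rewrite -{1}(g'K x) fK.
case: g' / f'g' gK g'K => gK g'K.
by congr Bijection; apply: Prop_irrelevance.
Qed.

HB.instance Definition _ := gen_eqMixin (bijection T).
HB.instance Definition _ := gen_choiceMixin (bijection T).

Definition bij_mul f g : bijection T :=
  Bijection (can_comp (bij_funK g) (bij_funK f))
            (can_comp (bij_invK f) (bij_invK g)).
Definition bij_one : bijection T :=
  @Bijection T id id (fun=> erefl) (fun=> erefl).
Definition bij_inverse f : bijection T := Bijection (bij_invK f) (bij_funK f).

Fact bij_mulA : associative bij_mul.
Proof. by move=> f g h; apply: bijection_eq. Qed.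
Fact bij_mul1 : left_id bij_one bij_mul.
Proof. by move=> f; apply: bijection_eq. Qed.
Fact bij_mulr1 : right_id bij_one bij_mul.
Proof. by move=> f; apply: bijection_eq. Qed.
Fact bij_mulV : left_inverse bij_one bij_inverse bij_mul.
Proof. by move=> f; apply: bijection_eq => x /=; apply: bij_invK. Qed.
Fact bij_mulrV : right_inverse bij_one bij_inverse bij_mul.
Proof. by move=> f; apply: bijection_eq => x /=; apply: bij_funK. Qed.

HB.instance Definition _ := isGroup.Build (bijection T)
  bij_mulA bij_mul1 bij_mulr1 bij_mulV bij_mulrV.

Lemma bij_mulE f g x : (f * g)%g x = g (f x). Proof. by []. Qed.
Lemma bij_oneE x : (1%g : bijection T) x = x. Proof. by []. Qed.

End BijectionGroup.

(** * Laurent polynomials and the opposite algebra *)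

(** The opposite algebra, on which the anti-automorphism of the Hecke algebra is
    defined by the universal property. *)
Section ConverseAlgebra.
Local Open Scope ring_scope.
Variables (K : comNzRingType) (A : algType K).
HB.instance Definition _ := GRing.Lmodule.on A^c.
Fact converse_scalerAl (a : K) (x y : A^c) : a *: (x * y) = (a *: x : A^c) * y.
Proof. exact: (@scalerAr K A a y x). Qed.
HB.instance Definition _ :=
  GRing.Lmodule_isLalgebra.Build K A^c converse_scalerAl.
Fact converse_scalerAr (a : K) (x y : A^c) : a *: (x * y) = x * (a *: y : A^c).
Proof. exact: (@scalerAl K A a y x). Qed.
HB.instance Definition _ :=
  GRing.Lalgebra_isAlgebra.Build K A^c converse_scalerAr.
End ConverseAlgebra.

Section Laurent.
Local Open Scope ring_scope.
Implicit Types p q : {poly int}.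

Fact laurent_of_poly_is_zmod_morphism : zmod_morphism laurent_of_poly.
Proof. by move=> p q; apply: val_inj; rewrite /= rmorphB. Qed.
HB.instance Definition _ := GRing.isZmodMorphism.Build _ _ laurent_of_poly
  laurent_of_poly_is_zmod_morphism.
Fact laurent_of_poly_is_monoid_morphism : monoid_morphism laurent_of_poly.
Proof.
by split=> [|p q]; apply: val_inj; rewrite /= ?rmorph1 ?rmorphM.
Qed.
HB.instance Definition _ := GRing.isMonoidMorphism.Build _ _ laurent_of_poly
  laurent_of_poly_is_monoid_morphism.

Lemma laurent_of_poly_inj : injective laurent_of_poly.
Proof. by move=> p q [] /eqP; rewrite tofrac_eq => /eqP. Qed.

Lemma laurent_of_polyE p :
  laurent_of_poly p = \sum_(i < size p) (p`_i)%:~R * lv ^+ i.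
Proof.
rewrite -{1}(coefK p) poly_def rmorph_sum /=; apply: eq_bigr => i _.
by rewrite -mul_polyC rmorphM rmorphXn /= -/lv -[X in X%:P]intz rmorph_int /= rmorph_int.
Qed.

Definition eval_vinv p : laurent := \sum_(i < size p) (p`_i)%:~R * lvinv ^+ i.

(** Multiplied by v^d, where d is the degree of p, the left side has degree less
    than d and the right side has degree 2 d. *)
Lemma eval_vinv_eq0 p : p`_0 = 0 -> eval_vinv p = laurent_of_poly p -> p = 0.
Proof.
move=> p0 pE; apply/eqP; apply: contraT => nz_p.
have [d szp] : exists d, size p = d.+1.
  by exists (size p).-1; rewrite prednK // size_poly_gt0.
have vk i : (i <= d)%N -> lvinv ^+ i * lv ^+ d = lv ^+ (d - i).
  move=> le_id; rewrite -{1}(subnKC le_id) exprD mulrA -exprMn mulrC.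
  by rewrite [lvinv * _]mulrC lv_vinv expr1n mulr1.
have : laurent_of_poly ('X^d * p) =
       laurent_of_poly (\sum_(i < size p) (p`_i)%:P * 'X^(d - i)).
  rewrite rmorphM rmorphXn /= -/lv -pE /eval_vinv mulr_sumr rmorph_sum /=.
  apply: eq_bigr => i _; rewrite mulrCA [lv ^+ d * _]mulrC vk; last first.
    by rewrite -ltnS -szp.
  by rewrite rmorphM rmorphXn /= -/lv -[X in X%:P]intz !rmorph_int.
move/laurent_of_poly_inj => E.
have := size_mulXn d nz_p; rewrite mulrC E szp => szE.
have : (size (\sum_(i < size p) (p`_i)%:P * 'X^(d - i))%R <= d)%N.
  apply: leq_trans (size_sum _ _ _) _; apply/bigmax_leqP => -[[|i] lti] _ /=.
    by rewrite p0 mul0r size_poly0.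
  rewrite mul_polyC; apply: leq_trans (size_scale_leq _ _) _.
  by rewrite size_polyXn; move: lti; rewrite szp; lia.
by rewrite szp szE; lia.
Qed.

End Laurent.

(** * Simply laced Coxeter groups and their Hecke algebras *)

Record simply_laced (S : finType) (e : rel S) (m : S -> S -> nat) : Prop := {
  sl_sym : symmetric e;
  sl_diag : forall s, m s s = 1%N;
  sl_offdiag : forall s t, s != t -> m s t = if e s t then 3%N else 2%N
}.

Section SimplyLaced.
Local Open Scope ring_scope.
Variables (S : finType) (e : rel S) (m : S -> S -> nat).
Hypothesis sl : simply_laced e m.
Variable W : coxeter_system m.
Implicit Types (s t r : S) (w x y : W) (a : S -> int).

Let e_sym := sl_sym sl.
Let m_diag := sl_diag sl.
Let m_offdiag := sl_offdiag sl.

Local Notation g := (cox_gen W).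
Local Notation len := (@cox_length S m W).
Local Notation word := (word_prod W).
Local Notation le := (@bruhat_le S m W).

Lemma gen_braid s t : s != t -> e s t -> (g s * g t * g s = g t * g s * g t)%g.
Proof.
move=> st est; have := @cox_rel _ _ W s t.
rewrite m_offdiag // est !expgS expg0 mulg1 => rel3.
apply: (mulIg (g t * g s * g t)%g); rewrite -!mulgA.
by move: rel3; rewrite -!mulgA => ->; rewrite !genKl ?gen_mul.
Qed.

Lemma gen_comm s t : ~~ e s t -> (g s * g t = g t * g s)%g.
Proof.
have [->//|st] := eqVneq s t; move=> /negPf est; have := @cox_rel _ _ W s t.
rewrite m_offdiag // est !expgS expg0 mulg1 => rel.
apply: (mulIg (g s * g t)%g); rewrite rel -!mulgA.
by rewrite !genKl ?gen_mul.
Qed.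

(** ** Weights *)

(** The simple reflection s on weights, in coordinates with respect to the
    fundamental weights: a s is the pairing of a with the simple coroot of s. *)
Definition fire s a : S -> int := fun r =>
  if r == s then - a s else if e s r then a r + a s else a r.

Lemma fire_self s a : fire s a s = - a s. Proof. by rewrite /fire eqxx. Qed.

Lemma fire_adj s a r : r != s -> e s r -> fire s a r = a r + a s.
Proof. by rewrite /fire => /negPf-> ->. Qed.

Lemma fire_far s a r : r != s -> ~~ e s r -> fire s a r = a r.
Proof. by rewrite /fire => /negPf-> /negPf->. Qed.

Lemma fire_invol s : involutive (fire s).
Proof.
move=> a; apply/funext=> r; rewrite /fire eqxx.
have [->|rs] := eqVneq r s; first by ring.
by case: (e s r); ring.
Qed.

Definition fire_bij s : bijection (S -> int) :=
  Bijection (fire_invol s) (fire_invol s).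

Lemma fire_rel : coxeter_relations m fire_bij.
Proof.
move=> s t; apply: bijection_eq => a.
have [<-|st] := eqVneq s t.
  by rewrite m_diag expg1 bij_mulE /= fire_invol.
rewrite m_offdiag //; have ts : t != s by rewrite eq_sym.
have ets : e t s = e s t by rewrite e_sym.
case: ifP => est; rewrite ?expgS expg0 mulg1 !bij_mulE bij_oneE /=;
  apply/funext=> r; rewrite /fire !eqxx ?(negPf st) ?(negPf ts) ?ets ?est.
- have [->|rs] := eqVneq r s; first by rewrite ?(negPf st) ?ets ?est; ring.
  have [->|rt] := eqVneq r t; first by rewrite ?(negPf ts) ?ets ?est; ring.
  by case: (e s r); case: (e t r); ring.
- have [->|rs] := eqVneq r s; first by rewrite ?(negPf st) ?ets ?est; ring.
  have [->|rt] := eqVneq r t; first by rewrite ?(negPf ts) ?ets ?est; ring.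
  by case: (e s r); case: (e t r); ring.
Qed.

Lemma weight_action : exists act : W -> (S -> int) -> (S -> int),
  (forall a, act 1%g a = a) /\
  (forall w x a, act (w * x)%g a = act x (act w a)) /\
  (forall s a, act (g s) a = fire s a).
Proof.
have [phi phiE] := cox_univ W fire_rel; exists (fun w => bij_fun (phi w)).
split; last by split=> [w x a|s a]; rewrite ?gmulfM ?phiE.
have phi1 : phi 1%g = 1%g by apply: (mulgI (phi 1%g)); rewrite -gmulfM !mulg1.
by move=> a; rewrite phi1.
Qed.

Definition wact : W -> (S -> int) -> (S -> int) := sval (cid weight_action).

Lemma wact1 a : wact 1 a = a.
Proof. by rewrite /wact; case: cid => ? []. Qed.

Lemma wactM w x a : wact (w * x)%g a = wact x (wact w a).
Proof. by rewrite /wact; case: cid => ? [? []]. Qed.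

Lemma wact_gen s a : wact (g s) a = fire s a.
Proof. by rewrite /wact; case: cid => ? [? []]. Qed.

Lemma wactS w s a : wact (w * g s)%g a = fire s (wact w a).
Proof. by rewrite wactM wact_gen. Qed.

(** Induction on the length of w.  Compare an ascent s of w with a descent t of w,
    inside the coset of w for the dihedral group of s and t: in rank two, the
    coordinate at s of the moved weight is a sum of coordinates at ascents of a
    shorter element of the coset, or one of them. *)
Lemma wact_asc (c : int) a : 0 <= c -> (forall s, c <= a s) ->
  forall w s, ~~ desc w s -> c <= wact w a s.
Proof.
move=> c0 ac w; have [k] := ubnP (len w); elim: k w => // k IH w lw s ws.
have [->|w1] := eqVneq w 1%g; first by rewrite wact1.
have [t wt] := exists_desc m_diag w1.
have st : s != t by apply: contraNneq ws => ->.
have lwt := length_desc m_diag wt; set x := (w * g t)%g in lwt.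
have wE : w = (x * g t)%g by rewrite /x genK.
have xt : ~~ desc x t by rewrite desc_mul ?wt.
have lws := length_asc m_diag ws.
have [est|est] := boolP (e s t).
  have [xs|xs] := boolP (desc x s); last first.
    rewrite wE wactS fire_adj 1?e_sym //.
    have := IH x _ s xs; have := IH x _ t xt; lia.
  set y := (x * g s)%g; have lxs := length_desc m_diag xs.
  have xE : x = (y * g s)%g by rewrite /y genK.
  have -> : wact w a s = wact y a t.
    rewrite wE xE !wactS (@fire_adj t _ s) 1?e_sym // (fire_self s).
    by rewrite (@fire_adj s _ t) 1?eq_sym // addrC addrK.
  rewrite -/y in lxs; apply: IH; first by lia.
  apply/negP=> yt; have lyt := length_desc m_diag yt.
  have wsE : (w * g s = y * g t * g s * g t)%g.
    rewrite wE xE; transitivity (y * (g s * g t * g s))%g; first by rewrite !mulgA.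
    by rewrite gen_braid // !mulgA.
  have := length_mulr (y * g t * g s)%g t; have := length_mulr (y * g t)%g s.
  by rewrite -wsE; lia.
rewrite wE wactS fire_far 1?e_sym //; apply: IH; first by lia.
apply/negP=> xs; have lxs := length_desc m_diag xs.
have wsE : (w * g s = x * g s * g t)%g by rewrite wE -mulgA -gen_comm // mulgA.
by have := length_mulr (x * g s)%g t; rewrite -wsE; lia.
Qed.

(** As rho is regular, the bound c = 1 of wact_asc makes it detect all descents. *)
Definition rho : S -> int := fun=> 1.

Lemma desc_rho w s : desc w s = (wact w rho s < 0).
Proof.
have asc x : ~~ desc x s -> 1 <= wact x rho s.
  by move=> xs; apply: wact_asc xs => // r; rewrite /rho.
have [ws|/asc] := boolP (desc w s); last by lia.
have := asc (w * g s)%g; rewrite desc_mul // ws => /(_ isT).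
by rewrite wactS fire_self; lia.
Qed.

Lemma wact_desc a w s : (forall r, 0 <= a r) -> desc w s -> wact w a s <= 0.
Proof.
move=> a0 ws; have := @wact_asc 0 a (lexx _) a0 (w * g s)%g s.
by rewrite desc_mul // ws wactS fire_self => /(_ isT); lia.
Qed.

Lemma asc_wact a w s : (forall r, 0 <= a r) -> 0 < wact w a s -> ~~ desc w s.
Proof. by move=> a0; apply: contraTN => /(wact_desc a0); lia. Qed.

Lemma desc_gen s t : desc (g s) t = (s == t).
Proof.
rewrite desc_rho wact_gen /fire /rho [t == s]eq_sym.
by case: eqP => // _; case: ifP.
Qed.

Lemma gen_inj : injective g.
Proof. by move=> s t gst; apply/eqP; rewrite -desc_gen gst desc_gen. Qed.

Lemma gen_commP s t : s != t -> (g s * g t == g t * g s)%g = ~~ e s t.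
Proof.
move=> st; have [est|/gen_comm->] := boolP (e s t); last exact: eqxx.
apply/negP=> /eqP comm; have := gen_braid st est.
rewrite comm genK // -comm genK // => /gen_inj ts.
by rewrite ts eqxx in st.
Qed.

Lemma desc_comm_pair w s t : s != t -> ~~ e s t -> desc w s -> desc w t ->
  len w = (len (w * g s * g t)%g).+2.
Proof.
move=> st est ws wt; have lws := length_desc m_diag ws.
suff /(length_desc m_diag) : desc (w * g s)%g t by rewrite lws => ->.
rewrite desc_rho wactS fire_far 1?eq_sym //; by rewrite -desc_rho.
Qed.

Lemma desc_braid_pair w s t : s != t -> e s t -> desc w s -> desc w t ->
  len w = (len (w * g s * g t * g s)%g).+3.
Proof.
move=> st est ws wt; have lws := length_desc m_diag ws.
have ts : t != s by rewrite eq_sym.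
have d2 : desc (w * g s)%g t.
  rewrite desc_rho wactS fire_adj //.
  by move: ws wt; rewrite !desc_rho; lia.
have d3 : desc (w * g s * g t)%g s.
  rewrite desc_rho !wactS (@fire_adj t _ s) 1?e_sym // fire_self.
  by rewrite (@fire_adj s _ t) // addrC addrK -desc_rho.
by rewrite lws (length_desc m_diag d2) (length_desc m_diag d3).
Qed.

(** Matsumoto's theorem: two reduced words with different last letters s and t
    can both be compared with a reduced word that ends with the longest element
    of the dihedral group of s and t. *)
Theorem matsumoto (A : pzSemiRingType) (f : S -> A) :
  (forall s t, \prod_(r <- alternating s t (m s t)) f r =
               \prod_(r <- alternating t s (m s t)) f r) ->
  forall u v, size u = len (word u) -> size v = len (word v) ->
  word u = word v -> \prod_(r <- u) f r = \prod_(r <- v) f r.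
Proof.
move=> fbraid u v su sv uv; have [k] : exists k, size u = k by exists (size u).
elim: k u v su sv uv => [|k IH] u v su sv uv.
  move=> u0; have v0 : size v = 0%N by rewrite sv -uv -su.
  by rewrite (size0nil u0) (size0nil v0).
case/lastP: u su uv => // u s su uv; rewrite size_rcons => -[szu].
case/lastP: v sv uv => [|v t] sv uv.
  by move: su; rewrite uv -sv size_rcons.
have szv : size v = k.
  by move: sv; rewrite -uv -su !size_rcons szu => -[].
have lw : len (word (rcons u s)) = k.+1 by rewrite -su size_rcons szu.
set w := word _ in uv lw; have uE : word u = (w * g s)%g.
  by rewrite /w word_rcons genK.
have vE : word v = (w * g t)%g by rewrite uv word_rcons genK.
have ws : desc w s by rewrite /desc -uE lw ltnS -szu length_word.
have wt : desc w t by rewrite /desc -vE lw ltnS -szv length_word.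
have lu : size u = len (word u).
  by have := length_desc m_diag ws; rewrite lw -uE szu => -[].
have lv : size v = len (word v).
  by have := length_desc m_diag wt; rewrite lw -vE szv => -[].
rewrite !big_rcons /=.
have [st|st] := eqVneq s t.
  by subst t; congr (_ * _); apply: IH => //; rewrite uE vE.
have IHu x z : w = (x * word (rcons z s))%g ->
    (size (rcons z s) + len x)%N = k.+1 ->
    \prod_(q <- u) f q = \prod_(q <- reduced_word x ++ z) f q.
  rewrite word_rcons mulgA => wE szr.
  have xr : word (reduced_word x ++ z) = word u.
    by rewrite uE wE genK // word_cat reduced_wordE.
  apply: IH; rewrite ?xr //.
  by rewrite size_cat size_reduced_word -lu szu; move: szr; rewrite size_rcons; lia.
have IHv x z : w = (x * word (rcons z t))%g ->
    (size (rcons z t) + len x)%N = k.+1 ->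
    \prod_(q <- v) f q = \prod_(q <- reduced_word x ++ z) f q.
  rewrite word_rcons mulgA => wE szr.
  have xr : word (reduced_word x ++ z) = word v.
    by rewrite vE wE genK // word_cat reduced_wordE.
  apply: IH; rewrite ?xr //.
  by rewrite size_cat size_reduced_word -lv szv; move: szr; rewrite size_rcons; lia.
have := fbraid s t; rewrite m_offdiag //.
case: ifP => [est|/negbT est]; rewrite /alternating /mkseq /= !big_cons big_nil !mulr1.
  have := desc_braid_pair st est ws wt; set x := (w * _ * _ * _)%g => lx br.
  rewrite (IHu x [:: s; t]); last 2 first.
  - by rewrite /= !word_cons word_nil mulg1 !mulgA !genK.
  - by rewrite /= -lw lx.
  rewrite (IHv x [:: t; s]); last 2 first.
  - have -> : word (rcons [:: t; s] t) = (g s * g t * g s)%g.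
      by rewrite /= !word_cons word_nil mulg1 gen_braid // mulgA.
    by rewrite !mulgA !genK.
  - by rewrite /= -lw lx.
  by rewrite !big_cat /= !big_cons !big_nil !mulr1 -!mulrA br.
have := desc_comm_pair st est ws wt; set x := (w * _ * _)%g => lx br.
rewrite (IHu x [:: t]); last 2 first.
- by rewrite /= !word_cons word_nil mulg1 !mulgA !genK.
- by rewrite /= -lw lx.
rewrite (IHv x [:: s]); last 2 first.
- by rewrite /= !word_cons word_nil mulg1 gen_comm // !mulgA !genK.
- by rewrite /= -lw lx.
by rewrite !big_cat /= !big_cons !big_nil !mulr1 -!mulrA br.
Qed.

(** ** The standard basis of the Hecke algebra *)

Variable H : hecke_algebra m.
Implicit Types (h : H) (c d : W -> laurent) (p : W -> {poly int}).

Local Notation T := (hecke_gen H).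
Local Notation std := (@std_basis S m W H).
Local Notation q := (lvinv - lv).

Lemma hecke_sqr s : T s * T s = 1 + q *: T s.
Proof.
have [_ /(_ s)] := hecke_rel H.
rewrite mulrDl !mulrDr !mulrN !mulr_algr !mulr_algl scalerA [lvinv * _]mulrC lv_vinv scale1r.
move/eqP; rewrite addr_eq0 opprB subr_eq => /eqP->.
by rewrite scalerBl -addrA [- _ + _]addrC.
Qed.

Lemma std_word u : size u = len (word u) -> std (word u) = \prod_(s <- u) T s.
Proof.
move=> szu; apply: matsumoto => //.
- by have [] := hecke_rel H.
- by rewrite reduced_wordE size_reduced_word.
- by rewrite reduced_wordE.
Qed.

Lemma std1 : std 1%g = 1.
Proof. by rewrite -(word_nil W) std_word ?word_nil ?length1 // big_nil. Qed.

Lemma std_mul_asc w s : ~~ desc w s -> std w * T s = std (w * g s)%g.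
Proof.
move=> ws; rewrite -[in RHS](reduced_wordE w) -word_rcons std_word.
  by rewrite big_rcons.
by rewrite size_rcons size_reduced_word word_rcons reduced_wordE length_asc.
Qed.

Lemma std_mul w s :
  std w * T s = std (w * g s)%g + (if desc w s then q else 0) *: std w.
Proof.
case: ifP => ws; last by rewrite scale0r addr0 std_mul_asc // ws.
have wE : std (w * g s)%g * T s = std w by rewrite std_mul_asc ?genK // desc_mul ?ws.
by rewrite -wE -mulrA hecke_sqr mulrDr mulr1 -scalerAr wE.
Qed.

(** ** The regular representation *)

Let N := #|W|.-1.

Lemma card_basis : N.+1 = #|W|.
Proof. by rewrite prednK //; apply/card_gt0P; exists 1%g. Qed.
Definition basis_idx w : 'I_N.+1 :=
  cast_ord (esym card_basis) (enum_rank w).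
Definition basis_elt (i : 'I_N.+1) : W := enum_val (cast_ord card_basis i).

Lemma basis_eltK : cancel basis_elt basis_idx.
Proof. by move=> i; rewrite /basis_idx /basis_elt enum_valK cast_ordK. Qed.
Lemma basis_idxK : cancel basis_idx basis_elt.
Proof. by move=> w; rewrite /basis_idx /basis_elt cast_ordKV enum_rankK. Qed.

Definition basis_vec w : 'rV[laurent]_N.+1 := delta_mx 0 (basis_idx w).
Definition right_vec s w := basis_vec (w * g s)%g + (if desc w s then q else 0) *: basis_vec w.
Definition left_vec s w := basis_vec (g s * w)%g + (if desc w^-1%g s then q else 0) *: basis_vec w.
(* The matrices are locked, as unfolding their entries makes products of them
   intractable. *)
Fact matrix_key : unit. Proof. exact: tt. Qed.
Definition right_mx s : 'M[laurent]_N.+1 :=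
  locked_with matrix_key (\matrix_(i, j) right_vec s (basis_elt i) 0 j).
Definition left_mx s : 'M[laurent]_N.+1 :=
  locked_with matrix_key (\matrix_(i, j) left_vec s (basis_elt i) 0 j).

Lemma basis_vec_mul (A : 'M[laurent]_N.+1) (f : W -> 'rV_N.+1) w :
  A = \matrix_(i, j) f (basis_elt i) 0 j -> basis_vec w *m A = f w.
Proof.
by move=> ->; apply/rowP=> j; rewrite -rowE !mxE basis_idxK.
Qed.

Lemma basis_vecR s w : basis_vec w *m right_mx s = right_vec s w.
Proof. by apply: basis_vec_mul; rewrite /right_mx unlock. Qed.

Lemma basis_vecL s w : basis_vec w *m left_mx s = left_vec s w.
Proof. by apply: basis_vec_mul; rewrite /left_mx unlock. Qed.

Lemma eq_on_basis (A B : 'M[laurent]_N.+1) :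
  (forall w, basis_vec w *m A = basis_vec w *m B) -> A = B.
Proof.
by move=> AB; apply/row_matrixP=> i; rewrite !rowE -(basis_eltK i) [LHS]AB.
Qed.

(** The status of t as a right descent of w and of s w is the same unless
    s w = w t ([desc_mull]); in that case s is a left descent of w if and only if
    t is a right descent, and the two sides are equal by symmetry. *)
Lemma left_right_mx s t : left_mx s *m right_mx t = right_mx t *m left_mx s.
Proof.
apply: eq_on_basis => w; rewrite !mulmxA basis_vecL basis_vecR /left_vec /right_vec !mulmxDl.
rewrite -!scalemxAl 2!basis_vecR 2!basis_vecL /left_vec /right_vec !scalerDr !scalerA -!addrA mulgA.
congr (_ + _); rewrite invMg (cox_genV m_diag).
have [eqw|neq] := eqVneq (g s * w)%g (w * g t)%g.
  rewrite eqw (desc_mul m_diag).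
  have -> : (g t * w^-1 = w^-1 * g s)%g.
    by apply: (mulgI w); rewrite !mulgA -eqw mulgK mulgV mul1g.
  rewrite (desc_mul m_diag).
  have -> : desc w^-1%g s = desc w t.
    have -> : desc w^-1%g s = (len (g s * w)^-1%g < len w^-1%g)%N.
      by rewrite invMg cox_genV.
    by rewrite !lengthV // eqw.
  by [].
rewrite (desc_mull m_diag neq) (desc_mull m_diag (w := w^-1%g)); last first.
  by apply: contraNneq neq => E; rewrite -(inj_eq invg_inj) !invMg !cox_genV // E.
by rewrite addrCA [_ * _]mulrC.
Qed.

Lemma left_right_comm s t : GRing.comm (left_mx s) (right_mx t).
Proof. by rewrite /GRing.comm -!mulmxE left_right_mx. Qed.

(** The left multiplications carry the vector of 1 to all basis vectors.  This
    reduces a relation between right multiplications to its effect on that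
    vector, where only products of length at most three occur. *)
Lemma eq_on_basis1 (A B : 'M[laurent]_N.+1) :
  (forall s, GRing.comm (left_mx s) A) -> (forall s, GRing.comm (left_mx s) B) ->
  basis_vec 1%g *m A = basis_vec 1%g *m B -> A = B.
Proof.
move=> cA cB AB; apply: eq_on_basis => w.
have [k] := ubnP (len w); elim: k w => // k IH w lw.
have [->//|w1] := eqVneq w 1%g.
have /(exists_desc m_diag)[s ws] : w^-1%g != 1%g by rewrite invg_eq1.
have lws := length_desc m_diag ws.
set x := (g s * w)%g; have wE : w = (g s * x)%g by rewrite /x genKl.
have xV : (x^-1 = w^-1 * g s)%g by rewrite /x invMg cox_genV.
have : basis_vec x *m left_mx s = basis_vec w.
  by rewrite basis_vecL /left_vec -wE xV desc_mul // ws scale0r addr0.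
move=> <-; rewrite -!mulmxA !mulmxE cA cB -!mulmxE !mulmxA IH //.
by move: lw; rewrite -(lengthV m_diag w) lws -xV lengthV.
Qed.

Lemma right_mx_rel : @hecke_relations S m 'M[laurent]_N.+1 right_mx.
Proof.
have step w s : ~~ desc w s -> basis_vec w *m right_mx s = basis_vec (w * g s)%g.
  by move=> ws; rewrite basis_vecR /right_vec (negPf ws) scale0r addr0.
have d1 s : ~~ desc (1%g : W) s by rewrite /desc length1.
have dgen s t := desc_gen s t.
have mulE (A B : 'M[laurent]_N.+1) : A * B = A *m B by [].
split=> [s t|s]; last first.
  apply: eq_on_basis1 => [r|r|]; last 2 first.
  - exact: commr0.
  - have mulA (x : 'rV[laurent]_N.+1) k : x *m (k%:A : 'M[laurent]_N.+1) = k *: x.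
      by rewrite -scalemxAr; congr (_ *: _); apply: mulmx1.
    rewrite mulE mulmxA [X in X *m _]mulmxDr (step 1%g s (d1 s)) mul1g mulmx0.
    rewrite mulA mulmxBr mulA mulmxDl basis_vecR /right_vec gen_mul // dgen eqxx.
    rewrite -scalemxAl step // mul1g scalerDr scalerA [lvinv * _]mulrC lv_vinv.
    by rewrite scale1r scalerBl addrA subrK [X in X - _]addrC subrr.
  have alg k : GRing.comm (left_mx r) (k%:A) by rewrite /GRing.comm mulr_algl mulr_algr.
  by apply: commrM; [apply: commrD|apply: commrB] => //; apply: left_right_comm.
have [->|st] := eqVneq s t; first by [].
rewrite (m_offdiag st).
have ts : t != s by rewrite eq_sym.
have lr := left_right_comm.
case: ifP => est; rewrite /alternating /mkseq /= !big_cons big_nil !mulr1.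
  apply: eq_on_basis1.
  - move=> r; apply: commrM; [exact: lr|apply: commrM; exact: lr].
  - move=> r; apply: commrM; [exact: lr|apply: commrM; exact: lr].
  have d3 (a b : S) : a != b -> e a b -> ~~ desc (g a * g b)%g a.
    move=> ab eab; rewrite desc_rho !wactM !wact_gen //.
    have ba : b != a by rewrite eq_sym.
    by rewrite (@fire_adj b _ a) 1?e_sym // fire_self (@fire_adj a _ b).
  have prod3 (a b : S) : a != b -> e a b ->
      basis_vec 1%g *m (right_mx a * (right_mx b * right_mx a)) =
      basis_vec (g a * g b * g a)%g.
    move=> ab eab; rewrite -!mulmxE !mulmxA step ?d1 // mul1g step.
      by rewrite step // d3.
    by rewrite dgen.
  have ets : e t s by rewrite e_sym.
  apply: etrans (prod3 s t st est) (etrans _ (esym (prod3 t s ts ets))).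
  by rewrite (gen_braid st est).
apply: eq_on_basis1.
- by move=> r; apply: commrM; exact: lr.
- by move=> r; apply: commrM; exact: lr.
have prod2 (a b : S) : a != b ->
    basis_vec 1%g *m (right_mx a * right_mx b) = basis_vec (g a * g b)%g.
  by move=> ab; rewrite -mulmxE mulmxA step ?d1 // mul1g step ?dgen.
apply: etrans (prod2 s t st) (etrans _ (esym (prod2 t s ts))).
by rewrite gen_comm ?est.
Qed.

Definition lin c : H := \sum_w c w *: std w.

(** In the regular representation, H_w maps the vector of 1 to that of w. *)
Lemma lin_inj c d : lin c = lin d -> c =1 d.
Proof.
have [phi [phiE _]] := hecke_univ H right_mx_rel.
have phi_std w : basis_vec 1%g *m phi (std w) = basis_vec w.
  have [k] := ubnP (len w); elim: k w => // k IH w lw.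
  have [->|w1] := eqVneq w 1%g; first by rewrite std1 rmorph1; apply: mulmx1.
  have [s ws] := exists_desc m_diag w1; have lws := length_desc m_diag ws.
  have xs : ~~ desc (w * g s)%g s by rewrite (desc_mul m_diag) ws.
  rewrite -{1}(genK m_diag w s) -(std_mul_asc xs) rmorphM /= phiE -mulmxE mulmxA.
  rewrite IH; last by rewrite -ltnS -lws.
  by rewrite basis_vecR /right_vec (negPf xs) scale0r addr0 genK.
have coefE c' y : (basis_vec 1%g *m phi (lin c')) 0 (basis_idx y) = c' y.
  rewrite /lin linear_sum /= mulmx_sumr summxE (bigD1 y) //= big1 => [|w wy].
    by rewrite addr0 linearZ /= -scalemxAr phi_std !mxE !eqxx mulr1.
  rewrite linearZ /= -scalemxAr phi_std !mxE eqxx /=.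
  by rewrite (can_eq basis_idxK) eq_sym (negPf wy) mulr0.
by move=> cd y; rewrite -coefE cd coefE.
Qed.

(** ** The bar involution *)

Variables (bar : {rmorphism H -> H}).
Hypothesis hbar : is_bar bar.

Lemma lin_mul c s : lin c * T s =
  lin (fun y => c (y * g s)%g + (if desc y s then q * c y else 0)).
Proof.
rewrite /lin mulr_suml.
under eq_bigr => w _ do
  rewrite -scalerAl std_mul scalerDr scalerA.
rewrite big_split /= (reindex_inj (mulIg (g s))) /= -big_split /=.
apply: eq_bigr => w _; rewrite genK // scalerDl; congr (_ + _ *: _).
by case: ifP => _; rewrite ?mulr0 // mulrC.
Qed.

Lemma linD c d : lin c + lin d = lin (fun y => c y + d y).
Proof. by rewrite -big_split /=; apply: eq_bigr => w _; rewrite scalerDl. Qed.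

Lemma linZ k c : k *: lin c = lin (fun y => k * c y).
Proof. by rewrite scaler_sumr; apply: eq_bigr => w _; rewrite scalerA. Qed.

Lemma bar_gen s : bar (T s) = T s - q%:A.
Proof.
have [_ /(_ s)[barl barr]] := hbar.
have inv : T s * (T s - q%:A) = 1.
  by rewrite mulrBr hecke_sqr mulr_algr addrK.
by rewrite -[LHS]mulr1 -[X in _ * X = _]inv mulrA barl mul1r.
Qed.

Lemma bar_alg (f : {poly int}) :
  bar (laurent_of_poly f)%:A = (eval_vinv f)%:A.
Proof.
have alg (k : laurent) (a : int) j :
    (a%:~R * k ^+ j)%:A = a%:~R * (k%:A) ^+ j :> H.
  by rewrite -!/(in_alg H _) rmorphM rmorphXn rmorph_int.
rewrite laurent_of_polyE /eval_vinv !scaler_suml rmorph_sum.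
apply: eq_bigr => i _; have [barv _] := hbar.
by rewrite [in LHS]alg [RHS]alg rmorphM rmorphXn rmorph_int barv.
Qed.

Lemma bar_scale (f : {poly int}) h :
  bar (laurent_of_poly f *: h) = eval_vinv f *: bar h.
Proof. by rewrite -mulr_algl rmorphM /= bar_alg mulr_algl. Qed.

(** The bar involution sends T_s to T_s - q.  Along a reduced word this adds the
    element with the next letter and elements that are shorter, and no letter
    outside of J. *)
Lemma bar_std (J : pred S) u : all J u -> size u = len (word u) ->
  exists c, [/\ bar (std (word u)) = lin c, c (word u) = 1,
    forall y, y != word u -> (len (word u) <= len y)%N -> c y = 0 &
    forall y, c y != 0 -> exists2 z, all J z & y = word z].
Proof.
elim/last_ind: u => [|u s IH].
  move=> _ _; rewrite word_nil std1 rmorph1.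
  exists (fun y => (y == 1%g)%:R); split=> [||y /negPf->//|y].
  - rewrite /lin (bigD1 1%g) //= eqxx scale1r std1 big1 ?addr0 // => w /negPf->.
    by rewrite scale0r.
  - by rewrite eqxx.
  - by have [->|_] := eqVneq y 1%g; [exists [::]; rewrite ?word_nil|rewrite eqxx].
rewrite all_rcons => /andP[Js Ju]; rewrite size_rcons word_rcons => szw.
set x := word u in IH szw *; have lx : (len x <= size u)%N by apply: length_word.
have xs : ~~ desc x s by apply/negP=> /(length_desc m_diag); lia.
have lw := length_asc m_diag xs.
have szx : size u = len x by lia.
have [c [cE c1 c0 cJ]] := IH Ju szx.
exists (fun y => c (y * g s)%g + (if desc y s then q * c y else 0) - q * c y).
have wx : (x * g s)%g != x.
  by apply: contraTneq xs => E; move: lw; rewrite E; lia.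
split.
- rewrite -(std_mul_asc xs) rmorphM /= bar_gen cE mulrBr mulr_algr.
  rewrite lin_mul -scaleN1r 2!linZ linD; congr lin.
  by apply/funext=> y; rewrite mulN1r.
- rewrite genK // c1 desc_mul // xs /=.
  by rewrite addrK.
- move=> y yw; rewrite lw => ly.
  have cy : c y = 0 by apply: c0; [apply: contraTneq ly => ->|]; lia.
  rewrite cy mulr0 subr0 if_same addr0; apply: c0.
    by apply: contraNneq yw => <-; rewrite genK.
  have := descP m_diag y s; case: ifP; lia.
- move=> y; have [cy|] := eqVneq (c y) 0; last by move=> /cJ[z Jz ->] _; exists z.
  rewrite cy mulr0 subr0 if_same addr0 => /cJ[z Jz yE]; exists (rcons z s).
    by rewrite all_rcons Js.
  by rewrite word_rcons -yE genK.
Qed.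

Definition plin p : H := lin (fun y => laurent_of_poly (p y)).

Lemma plin_inj p p' : plin p = plin p' -> p =1 p'.
Proof.
by move=> /lin_inj E y; apply: laurent_of_poly_inj.
Qed.

(** By descending induction on the length of y, using the triangularity of bar:
    if p vanishes on all longer elements then p y is invariant under v -> v^-1. *)
Lemma bar_plin_eq0 p : (forall y, (p y)`_0 = 0) -> bar (plin p) = plin p ->
  forall y, p y = 0.
Proof.
move=> p0 barp; have ex x : exists c, [/\ bar (std x) = lin c, c x = 1 &
    forall y, y != x -> (len x <= len y)%N -> c y = 0].
  have [|c []] := bar_std (J := predT) (u := reduced_word x) (all_predT _).
    by rewrite reduced_wordE size_reduced_word.
  by rewrite reduced_wordE => cE c1 c0 _; exists c.
have [c cP] := choice ex.
have linE : lin (fun y => \sum_x eval_vinv (p x) * c x y) = plin p.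
  rewrite -barp /plin /lin rmorph_sum /=.
  under eq_bigr => y _ do rewrite scaler_suml.
  rewrite exchange_big /=; apply: eq_bigr => x _.
  have [cE _ _] := cP x; rewrite bar_scale cE /lin scaler_sumr.
  by apply: eq_bigr => y _; rewrite scalerA.
have coefE y : \sum_x eval_vinv (p x) * c x y = laurent_of_poly (p y).
  exact: (lin_inj linE y).
move=> y; have [k] := ubnP (len (longest W) - len y); elim: k y => // k IH y ly.
apply: eval_vinv_eq0 => //; rewrite -coefE (bigD1 y) //= big1 => [|x xy].
  by have [_ -> _] := cP y; rewrite mulr1 addr0.
have [lxy|lyx] := leqP (len x) (len y).
  by have [_ _ ->] := cP x; rewrite ?mulr0 // eq_sym.
by rewrite IH /eval_vinv ?size_poly0 ?big_ord0 ?mul0r //;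
  have := length_longest x; lia.
Qed.

(** The conditions of is_KL on a plain function: as p vanishes outside of the
    interval below w, the candidate for the element is plin p. *)
Definition KL_coefs w p :=
  [/\ p w = 1, forall y, y != w -> (p y)`_0 = 0,
      forall y, ~~ le y w -> p y = 0 & bar (plin p) = plin p].

Lemma KL_coefs_uniq w p p' : KL_coefs w p -> KL_coefs w p' -> p =1 p'.
Proof.
move=> [pw p0 _ bp] [p'w p'0 _ bp'] y; apply/eqP; rewrite -subr_eq0; apply/eqP.
have klB : plin (fun y => p y - p' y) = plin p - plin p'.
  rewrite /plin -scaleN1r linZ linD; apply: eq_bigr => x _.
  by rewrite rmorphB mulN1r.
apply: (@bar_plin_eq0 (fun y => p y - p' y)) y => [y|].
  rewrite coefB; have [->|yw] := eqVneq y w; first by rewrite pw p'w subrr.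
  by rewrite p0 // p'0 // subr0.
by rewrite klB rmorphB /= bp bp'.
Qed.

Lemma KL_polyE w p : KL_coefs w p -> forall y, KL_poly bar y w = p y.
Proof.
move=> pP y; have [pw p0 ps bp] := pP.
have sumE (f : W -> {poly int}) : f w = 1 -> (forall y, ~~ le y w -> f y = 0) ->
    std w + \sum_(y | bruhat_lt y w) laurent_of_poly (f y) *: std y = plin f.
  move=> fw fs; rewrite /plin /lin [RHS](bigD1 w) //= fw rmorph1 scale1r; congr (_ + _).
  rewrite big_mkcond [RHS]big_mkcond /=; apply: eq_bigr => x _.
  rewrite /bruhat_lt; case: (x == w) => //=; case: ifPn => // /fs->.
  by rewrite rmorph0 scale0r.
rewrite /KL_poly (@xget_unique _ _ (is_KL bar w) [ffun y => p y]).
- by rewrite ffunE.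
- split=> [|z /andP[zw _]|z zw|] /=.
  + by rewrite ffunE.
  + by rewrite ffunE p0.
  + by rewrite ffunE ps.
  + have klE : plin [ffun z => p z] = plin p.
      by apply: eq_bigr => z _; rewrite ffunE.
    by rewrite sumE ?klE ?bp // => [|z zw]; rewrite ffunE ?pw ?(ps _ zw).
move=> f [fw f0 fs]; rewrite /= sumE // => bf; apply/ffunP=> z; rewrite ffunE.
apply: (@KL_coefs_uniq w f p) => //; split=> // x xw.
have [le_xw|/fs->] := boolP (le x w); last by rewrite coef0.
by apply: f0; rewrite /bruhat_lt xw.
Qed.

(** ** Steps between Kazhdan-Lusztig elements *)

Definition hecke_C s : H := T s + lv%:A.
Definition quantum2 : laurent := lv + lvinv.
Local Notation C := hecke_C.
Local Notation q2 := quantum2.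

(** h C_s = (v + v^-1) h says that h is divisible by C_s.  A Kazhdan-Lusztig
    element has this property on one side for all descents of its index on that
    side; it is preserved by products with C_t for t that commute with s. *)
Definition rinv s h := h * C s = q2 *: h.
Definition linv s h := C s * h = q2 *: h.

(** C_s acts on the span of H_y and H_(y s) with rank one, so the condition fixes
    the ratio of the two coefficients. *)
Lemma rinv_lin c s :
  rinv s (lin c) <-> forall y, ~~ desc y s -> c y = lv * c (y * g s)%g.
Proof.
rewrite /rinv mulrDr lin_mul mulr_algr 2!linZ linD.
have vK (x y : laurent) : x = lv * y <-> y = lvinv * x.
  by split=> ->; rewrite mulrA ?lv_vinv ?[lvinv * _]mulrC ?lv_vinv mul1r.
split=> [/lin_inj E y ys|E].
  apply/vK; have := E y; rewrite (negPf ys) addr0 /q2 mulrDl addrC.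
  exact: addrI.
congr lin; apply/funext=> y; rewrite [RHS]mulrDl; case: ifP => ys.
  rewrite (E (y * g s)%g) ?desc_mul ?ys // genK // mulrBl addrA subrK //.
by rewrite addr0 addrC; congr (_ + _); apply/vK/E; rewrite ys.
Qed.

Lemma rinv_plin p s :
  rinv s (plin p) <-> forall y, ~~ desc y s -> p y = 'X * p (y * g s)%g.
Proof.
rewrite rinv_lin; split=> E y /E.
  by rewrite -[lv]/(laurent_of_poly 'X) -rmorphM => /laurent_of_poly_inj.
by move=> ->; rewrite rmorphM.
Qed.

Lemma KL_desc w p s : KL_coefs w p -> rinv s (plin p) -> desc w s.
Proof.
move=> [pw _ _ _] /rinv_plin E; apply: contraT => /E; rewrite pw.
by move/(congr1 (fun f : {poly int} => f`_0)); rewrite coefXM coef1.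
Qed.

Lemma bar_v : bar lvinv%:A = lv%:A.
Proof.
have vv : lv%:A * lvinv%:A = 1 :> H.
  by rewrite mulr_algl scalerA lv_vinv scale1r.
have [barv _] := hbar.
have E : lvinv%:A * bar lvinv%:A = 1 by rewrite -{1}barv -rmorphM vv rmorph1.
by rewrite -[LHS]mul1r -{1}vv -mulrA E mulr1.
Qed.

Lemma bar_C s : bar (C s) = C s.
Proof.
rewrite rmorphD /= bar_gen; have [-> _] := hbar.
by rewrite scalerBl opprB addrA subrK.
Qed.

Lemma bar_q2 h : bar (q2 *: h) = q2 *: bar h.
Proof.
rewrite -mulr_algl rmorphM scalerDl rmorphD /= bar_v; have [-> _] := hbar.
by rewrite -scalerDl mulr_algl addrC.
Qed.

(** At a descent y of s the product by C_s has the coefficient p_(y s) + v^-1 p_y;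
    dropping the first coefficient divides by v when p_y has no constant term. *)
Definition mulC p s y : {poly int} :=
  if desc y s then p (y * g s)%g + drop_poly 1 (p y)
  else 'X * p y + p (y * g s)%g.

Lemma plin_mulC p s : (forall y, desc y s -> (p y)`_0 = 0) ->
  plin p * C s = plin (mulC p s).
Proof.
move=> p0; rewrite mulrDr lin_mul mulr_algr linZ linD.
congr lin; apply/funext=> y; rewrite /mulC; case: ifP => ys; last first.
  by rewrite rmorphD rmorphM addr0 addrC.
rewrite rmorphD -addrA -mulrDl subrK; congr (_ + _).
have -> : p y = 'X * drop_poly 1 (p y).
  apply/polyP=> -[|i]; rewrite coefXM /= ?p0 //.
  by rewrite coef_drop_poly addn1.
rewrite rmorphM -/lv mulrA [lvinv * _]mulrC lv_vinv mul1r.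
congr laurent_of_poly; apply/polyP=> i.
by rewrite !coef_drop_poly coefXM addn1 /= coef_drop_poly addn1.
Qed.

(** The product with C_j is invariant under bar, and its coefficients are in
    v Z[v] up to the linear terms of the p_y with j a descent of y.  If k is an
    ascent of y and p is invariant under k then p_y = v p_(y k), which has a linear
    term only if y k = w.  So the constant terms are removed by subtracting the
    elements of the w k with descent j. *)
Theorem KL_step w j p (A : pred S) (K : seq S) (P : S -> W -> {poly int}) :
  KL_coefs w p -> ~~ desc w j -> (forall k, A k -> rinv k (plin p)) ->
  (forall y, p y != 0 -> desc y j -> exists2 k, A k & ~~ desc y k) ->
  uniq K ->
  (forall k, k \in K -> [/\ A k, desc (w * g k)%g j & KL_coefs (w * g k)%g (P k)]) ->
  (forall k, A k -> desc (w * g k)%g j -> k \in K) ->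
  exists2 p', KL_coefs (w * g j)%g p' &
    plin p' = plin p * C j - \sum_(k <- K) plin (P k).
Proof.
move=> pP wj Ainv asc uK KP AK; have [pw p0 ps pbar] := pP.
have lwj := length_asc m_diag wj.
have dp0 : drop_poly 1 0 = 0 :> {poly int}.
  by apply/polyP=> i; rewrite coef_drop_poly !coef0.
have dK k : k \in K -> desc w k.
  by case/KP=> Ak _ _; apply: KL_desc pP (Ainv _ Ak).
have klsum : \sum_(k <- K) plin (P k) = plin (fun y => \sum_(k <- K) P k y).
  rewrite /plin /lin exchange_big /=; apply: eq_bigr => y _.
  by rewrite rmorph_sum scaler_suml.
have pj0 y : desc y j -> (p y)`_0 = 0.
  by move=> yj; apply: p0; apply: contraNneq wj => <-.
exists (fun y => mulC p j y - \sum_(k <- K) P k y); last first.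
  rewrite plin_mulC // klsum -[- plin _]scaleN1r linZ linD; congr lin.
  by apply/funext=> y; rewrite rmorphB mulN1r.
have Pk0 k y : k \in K -> y != (w * g k)%g -> (P k y)`_0 = 0.
  by case/KP=> _ _ [_ + _ _]; apply.
have Pk1 k : k \in K -> P k (w * g k)%g = 1 by case/KP=> _ _ [].
have Pks k y : k \in K -> ~~ le y w -> P k y = 0.
  move=> kK yw; case/KP: (kK) => _ _ [_ _ + _]; apply.
  by apply: contra yw => /bruhat_trans; apply; exact: (bruhat_desc m_diag (dK _ kK)).
have le_w y : le y w -> le y (w * g j)%g.
  by move/bruhat_trans; apply; apply: bruhat_asc.
have long y : len y = (len w).+1 -> ~~ le y w.
  by move=> ly; apply/negP=> /bruhat_length_le; rewrite ly ltnn.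
split.
- rewrite /mulC desc_mul // wj genK // pw (ps (w * g j)%g) ?long //.
  rewrite dp0 addr0 big_seq big1 ?subr0 // => k kK.
  by rewrite Pks // long.
- move=> y yw; rewrite coefB coef_sum /mulC.
  have ys : (p (y * g j)%g)`_0 = 0.
    by apply: p0; apply: contraNneq yw => <-; rewrite genK.
  case: ifP => yj; rewrite coefD ys ?coefXM ?addr0 ?add0r; last first.
    rewrite big_seq big1 ?subr0 // => k kK; apply: Pk0 => //.
    by case/KP: (kK) => _ + _; apply: contraTneq => <-; rewrite yj.
  rewrite coef_drop_poly addn1; apply/eqP; rewrite subr_eq0; apply/eqP.
  have [/hasP[k kK /eqP yk]|noK] := boolP (has (fun k => y == w * g k)%g K).
    case/KP: (kK) => Ak _ _; have /rinv_plin := Ainv k Ak.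
    have dk := dK k kK; move=> /(_ y).
    rewrite yk desc_mul // dk genK // => /(_ isT)->.
    rewrite pw mulr1 coefX (bigD1_seq k) //= Pk1 // coef1 big_seq_cond big1 ?addr0 //.
    move=> k' /andP[k'K k'k]; apply: Pk0 => //.
    by apply: contraNneq k'k => /mulgI /(gen_inj)->.
  rewrite [RHS]big_seq big1 => [|k kK]; last first.
    by apply: Pk0 => //; apply: contraNneq noK => ->; apply/hasP; exists k.
  have [->|py] := eqVneq (p y) 0; first by rewrite coef0.
  have [k Ak yk] := asc y py yj; have /rinv_plin/(_ y yk)-> := Ainv k Ak.
  rewrite coefXM; apply: p0; apply: contraNneq noK => wE; apply/hasP; exists k.
    by apply: AK => //; rewrite -wE genK.
  by rewrite -wE genK.
- move=> y ywj; have yw : ~~ le y w by apply: contra ywj; apply: le_w.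
  rewrite big_seq big1 => [|k kK]; last exact: Pks.
  have ysw : p (y * g j)%g = 0.
    apply: ps; apply: contra ywj => /(bruhat_lift_asc m_diag)/(_ wj).
    by rewrite genK.
  by rewrite /mulC ysw ps // dp0 mulr0 !addr0 subr0 if_same.
- have klE : plin (fun y => mulC p j y - \sum_(k <- K) P k y) =
             plin p * C j - \sum_(k <- K) plin (P k).
    rewrite plin_mulC // klsum -[- plin _]scaleN1r linZ linD; congr lin.
    by apply/funext=> y; rewrite rmorphB mulN1r.
  rewrite klE rmorphB rmorphM /= pbar bar_C rmorph_sum /=; congr (_ - _).
  by rewrite big_seq [RHS]big_seq; apply: eq_bigr => k /KP[_ _ []].
Qed.

(** ** The anti-automorphism T_w -> T_(w^-1) *)

Lemma converse_rel : @hecke_relations S m H^c T.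
Proof.
have [braid quad] := hecke_rel H; split=> [s t|s].
  have [->//|st] := eqVneq s t; have := braid s t; rewrite (m_offdiag st).
  rewrite !rev_prodr; case: ifP => _; rewrite /alternating /mkseq /= => E.
    exact: E.
  exact: esym E.
have alg (h : H) k : GRing.comm h k%:A.
  by rewrite /GRing.comm mulr_algl mulr_algr.
have comm : GRing.comm (T s - lvinv%:A) (T s + lv%:A).
  by apply: commrD (alg _ _); apply: commr_sym; apply: commrB.
exact: etrans comm (quad s).
Qed.

(** T_w -> T_(w^-1) commutes with bar, as both are determined by generators. *)
Lemma exists_anti : exists tau : H -> H,
  [/\ forall c, tau (lin c) = lin (fun y => c y^-1%g),
      forall h h', tau (h * h') = tau h' * tau h,
      forall k h, tau (k *: h) = k *: tau h,
      forall s, tau (C s) = C s &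
      forall p, tau (bar (plin p)) = bar (tau (plin p))].
Proof.
have [phi [phiE _]] := hecke_univ H converse_rel.
exists (phi : H -> H).
have phi_word u : phi (\prod_(s <- u) T s) = \prod_(s <- rev u) T s :> H.
  elim: u => [|s u IH]; first by rewrite !big_nil rmorph1.
  rewrite big_cons rmorphM /= phiE rev_cons big_rcons /= -IH.
  by [].
have phi_std w : phi (std w) = std w^-1%g :> H.
  rewrite -[in RHS](reduced_wordE w) -word_rev //.
  rewrite std_word ?phi_word //.
  by rewrite word_rev // reduced_wordE lengthV // size_rev size_reduced_word.
have phi_lin c : phi (lin c) = lin (fun y => c y^-1%g).
  rewrite /lin linear_sum /= [RHS](reindex_inj invg_inj) /=.
  by apply: eq_bigr => w _; rewrite linearZ /= phi_std invgK.
have phi_bar w : phi (bar (std w)) = bar (std w^-1%g) :> H.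
  have barE u : bar (\prod_(s <- u) T s) = \prod_(s <- u) (T s - q%:A).
    rewrite rmorph_prod /=; apply: eq_bigr => s _; exact: bar_gen s.
  have phi_prod u : phi (\prod_(s <- u) (T s - q%:A)) =
      \prod_(s <- rev u) (T s - q%:A) :> H.
    elim: u => [|s u IH]; first by rewrite !big_nil rmorph1.
    rewrite big_cons rmorphM rmorphB /= phiE linearZ rmorph1 /= rev_cons.
    by rewrite big_rcons /= -IH.
  rewrite -phi_std /std_basis barE phi_prod phi_word barE.
  by [].
split=> [|h h'|k h|s|p] //.
- by rewrite rmorphM.
- by rewrite linearZ.
- by rewrite rmorphD /= phiE linearZ /= rmorph1.
- rewrite phi_lin /plin /lin rmorph_sum linear_sum /=.
  rewrite [X in bar X](reindex_inj invg_inj) /= rmorph_sum /=.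
  apply: eq_bigr => w _; rewrite invgK !bar_scale linearZ /=.
  by rewrite phi_bar.
Qed.

Lemma KL_coefsV w p : KL_coefs w p ->
  [/\ KL_coefs w^-1%g (fun y => p y^-1%g),
    forall s, rinv s (plin p) -> linv s (plin (fun y => p y^-1%g)) &
    forall s, linv s (plin p) -> rinv s (plin (fun y => p y^-1%g))].
Proof.
move=> [pw p0 ps pbar]; have [tau [tau_lin tauM tauZ tauC tau_bar]] := exists_anti.
have tauE : tau (plin p) = plin (fun y => p y^-1%g) by rewrite /plin tau_lin.
split=> [|s|s].
- split=> [|y yw|y yw|].
  + by rewrite invgK.
  + by apply: p0; rewrite -(inj_eq invg_inj) invgK.
  + by apply: ps; apply: contra yw => /(bruhatV m_diag); rewrite invgK.
  + by rewrite -tauE -tau_bar pbar.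
- move=> E; rewrite /linv -tauE -{1}(tauC s) -tauM.
  by rewrite (E : plin p * C s = _) tauZ.
- move=> E; rewrite /rinv -tauE -{1}(tauC s) -tauM.
  by rewrite (E : C s * plin p = _) tauZ.
Qed.

Lemma linv_plin p s : linv s (plin p) ->
  forall y, ~~ desc y^-1%g s -> p y = 'X * p (g s * y)%g.
Proof.
have [tau [tau_lin tauM tauZ tauC _]] := exists_anti.
move=> ps y ys; have : rinv s (plin (fun y => p y^-1%g)).
  have tauE : tau (plin p) = plin (fun y => p y^-1%g) by rewrite /plin tau_lin.
  rewrite /rinv -tauE -{1}(tauC s) -tauM.
  by rewrite (ps : C s * plin p = _) tauZ.
move/rinv_plin/(_ _ ys); rewrite invgK.
by rewrite invMg invgK (cox_genV m_diag).
Qed.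

Lemma KL_ldesc w p s : KL_coefs w p -> linv s (plin p) -> desc w^-1%g s.
Proof.
move=> pP ps; have [pP' _ inv] := KL_coefsV pP.
by have := KL_desc pP' (inv s ps).
Qed.

(** ** The longest element of a parabolic subgroup *)

Definition parabolic (J : pred S) w := `[< exists2 u, all J u & word u = w >].

Lemma parabolicP J w : reflect (exists2 u, all J u & word u = w) (parabolic J w).
Proof. exact: asboolP. Qed.

Lemma parabolic_mul (J : pred S) w s : J s -> parabolic J (w * g s)%g = parabolic J w.
Proof.
have half x : J s -> parabolic J x -> parabolic J (x * g s)%g.
  move=> Js /parabolicP[u Ju <-]; apply/parabolicP; exists (rcons u s).
    by rewrite all_rcons Js.
  by rewrite word_rcons.
by move=> Js; apply/idP/idP; [rewrite -{2}(genK m_diag w s)|]; apply: half.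
Qed.

Lemma parabolicV J w : parabolic J w^-1%g = parabolic J w.
Proof.
have half x : parabolic J x -> parabolic J x^-1%g.
  move=> /parabolicP[u Ju <-]; apply/parabolicP; exists (rev u).
    by rewrite all_rev.
  by rewrite word_rev.
by apply/idP/idP => [/half|/half //]; rewrite invgK.
Qed.

Lemma parabolic1 J : parabolic J 1%g.
Proof. by apply/parabolicP; exists [::]; rewrite ?word_nil. Qed.

(** Invariance under the generators in J determines the coefficients on the
    parabolic subgroup from the coefficient 1 at w.  Since bar preserves the
    invariance, and the coefficient at w by triangularity, it fixes the element. *)
Lemma KL_parabolic (J : pred S) : exists w p,
  [/\ parabolic J w, KL_coefs w p,
    forall s, J s -> rinv s (plin p) /\ linv s (plin p),
    p 1%g = 'X^(len w) &
    forall y, p y != 0 -> parabolic J y].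
Proof.
have [w Jw wmax] : exists2 w, parabolic J w & forall y, parabolic J y -> (len y <= len w)%N.
  by case: (arg_maxnP len (parabolic1 J)) => w Jw wmax; exists w.
have wJ s : J s -> desc w s.
  move=> Js; apply: contraT => /(length_asc m_diag) lw.
  have := wmax (w * g s)%g; rewrite parabolic_mul // => /(_ Jw).
  by rewrite lw ltnn.
have le_w y : parabolic J y -> le y w.
  by move=> /parabolicP[u Ju <-]; apply: bruhat_parabolic wJ Ju.
have asc y : parabolic J y -> y != w -> exists2 s, J s & ~~ desc y s.
  move=> Jy yw; have [[s [Js ys]]|no] := pselect (exists s, J s /\ ~~ desc y s).
    by exists s.
  have yJ s : J s -> desc y s.
    by move=> Js; apply: contraT => ys; case: no; exists s.
  have : le w y by case/parabolicP: Jw => u Ju <-; apply: bruhat_parabolic yJ Ju.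
  case/bruhat_length=> [wy|]; first by rewrite wy eqxx in yw.
  by rewrite ltnNge wmax.
pose p y : {poly int} := if parabolic J y then 'X^(len w - len y) else 0.
have pinv s : J s -> rinv s (plin p).
  move=> Js; apply/rinv_plin => y ys.
  rewrite /p parabolic_mul //; case: ifP => Jy; last by rewrite mulr0.
  have ly := length_asc m_diag ys; rewrite -exprS ly; congr ('X^_).
  have := wmax (y * g s)%g; rewrite parabolic_mul // ly => /(_ Jy); lia.
have pw : p w = 1 by rewrite /p Jw subnn.
have pbar : bar (plin p) = plin p.
  have /choice[c cP] z : exists c, parabolic J z -> [/\ bar (std z) = lin c, c z = 1,
      forall y, y != z -> (len z <= len y)%N -> c y = 0 &
      forall y, c y != 0 -> parabolic J y].
    have [Jz|nJz] := boolP (parabolic J z); last by exists (fun=> 0).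
    have [u Ju uz] := parabolicP J z Jz.
    have [v [Jv vz szv]] := reduced_subword m_diag W Ju.
    have zE : word v = z by rewrite vz.
    have szE : size v = len (word v) by rewrite szv vz.
    have [c [cE c1 c0 cJ]] := bar_std Jv szE.
    exists c => _; rewrite -zE; split=> // y /cJ[x Jx ->].
    by apply/parabolicP; exists x.
  pose d y := \sum_(z | parabolic J z) eval_vinv (p z) * c z y.
  have dE : bar (plin p) = lin d.
    rewrite /plin /lin rmorph_sum /= (bigID (parabolic J)) /= [X in _ + X]big1 => [|z nJz].
      rewrite addr0; under [RHS]eq_bigr => y _ do rewrite scaler_suml.
      rewrite exchange_big /=; apply: eq_bigr => z Jz.
      have [cE _ _ _] := cP z Jz; rewrite bar_scale cE /lin scaler_sumr.
      by apply: eq_bigr => y _; rewrite scalerA.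
    by rewrite /p (negPf nJz) rmorph0 scale0r rmorph0.
  have dw : d w = 1.
    rewrite /d (bigD1 w) //= big1 => [|z /andP[Jz zw]].
      have [_ -> _ _] := cP w Jw.
      by rewrite pw /eval_vinv size_poly1 big_ord1 coef1 expr0 mulr1 mulr1 addr0.
    by have [_ _ -> //] := cP z Jz; rewrite ?mulr0 ?wmax // eq_sym.
  have d0 y : ~~ parabolic J y -> d y = 0.
    move=> nJy; apply: big1 => z Jz; have [_ _ _ cJ] := cP z Jz.
    have [->|/cJ Jy] := eqVneq (c z y) 0; first by rewrite mulr0.
    by rewrite Jy in nJy.
  have dinv s : J s -> forall y, ~~ desc y s -> d y = lv * d (y * g s)%g.
    move=> Js; apply/rinv_lin.
    rewrite -dE /rinv -[X in _ * X]bar_C -rmorphM /=.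
    by rewrite (pinv s Js : plin p * C s = _) bar_q2.
  rewrite dE; congr lin; apply/funext=> y.
  have [Jy|nJy] := boolP (parabolic J y); last by rewrite d0 // /p (negPf nJy) rmorph0.
  have [k] := ubnP (len w - len y)%N; elim: k y Jy => // k IH y Jy ly.
  have [->|/(asc y Jy)[s Js ys]] := eqVneq y w; first by rewrite dw pw rmorph1.
  have lys := length_asc m_diag ys.
  have Jys : parabolic J (y * g s)%g by rewrite parabolic_mul.
  have := (rinv_plin p s).1 (pinv s Js) y ys => ->.
  rewrite (dinv s Js y ys) IH ?rmorphM //; have := wmax _ Jys; lia.
have pP : KL_coefs w p.
  split=> // y yw; last first.
    by rewrite /p; case: ifP => // /le_w le_yw; rewrite le_yw in yw.
  rewrite /p; case: ifP => Jy; last by rewrite coef0.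
  rewrite coefXn; case/bruhat_length: (le_w y Jy) => [E|]; first by rewrite E eqxx in yw.
  by rewrite -subn_gt0; case: (len w - len y)%N.
exists w, p; split=> //.
- move=> s Js; split; first exact: pinv.
  have [_ /(_ s (pinv s Js)) + _] := KL_coefsV pP.
  suff -> : plin (fun y => p y^-1%g) = plin p by [].
  by apply: eq_bigr => y _; rewrite /p parabolicV lengthV.
- by rewrite /p parabolic1 length1 subn0.
- by move=> y; rewrite /p; case: ifP => // _; rewrite eqxx.
Qed.

(** ** Invariance under the C_s *)

Lemma C_sqr s : C s * C s = q2 *: C s.
Proof.
have TT : T s * T s + lv *: T s = 1 + lvinv *: T s.
  by rewrite hecke_sqr -addrA -scalerDl subrK.
rewrite mulrDl !mulrDr !mulr_algr mulr_algl TT [RHS]scalerDr !scalerDl.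
rewrite [X in _ = _ + (_ + X)]scalerA [lvinv * _]mulrC lv_vinv scale1r.
by rewrite (AC (2*2) ((3*2)*(4*1))).
Qed.

Lemma C_comm s t : ~~ e s t -> C s * C t = C t * C s.
Proof.
move=> est; have [->//|st] := eqVneq s t.
have [/(_ s t) + _] := hecke_rel H.
rewrite m_offdiag // (negPf est) /alternating /mkseq /= !big_cons !big_nil !mulr1.
move=> br; rewrite !mulrDl !mulrDr !mulr_algr !mulr_algl br -!addrA; congr (_ + _).
by rewrite addrCA.
Qed.

(** The right side is symmetric in s and t up to the braid relation. *)
Lemma C_braid_expand s t : C s * C t * C s - C s =
  T s * (T t * T s) + (lv *: (T s * T t + T t * T s) +
    (lv ^+ 2 *: (T s + T t) + (lv ^+ 3)%:A)).
Proof.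
have TT : lv *: (T s * T s) + lv ^+ 2 *: T s = C s.
  rewrite hecke_sqr scalerDr scalerA mulrBr lv_vinv -expr2 -addrA -scalerDl.
  by rewrite subrK scale1r addrC.
have CtCs : C t * C s = T t * T s + lv *: T t + (lv *: T s + (lv ^+ 2)%:A).
  by rewrite mulrDl !mulrDr !mulr_algr mulr_algl scalerA -expr2.
apply/eqP; rewrite subr_eq -mulrA CtCs {1}/hecke_C mulrDl !mulrDr -TT.
rewrite !mulr_algl !mulr_algr -!scalerAr !scalerDr !scalerA -!exprS.
apply/eqP; rewrite -!expr2.
by rewrite [LHS](AC ((2*2)*(2*2)) ((1*((2*5)*((7*6)*8)))*(3*4))).
Qed.

Lemma C_braid s t : s != t -> e s t ->
  C s * C t * C s - C s = C t * C s * C t - C t.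
Proof.
move=> st est; rewrite !C_braid_expand; have [/(_ s t) + _] := hecke_rel H.
rewrite m_offdiag // est /alternating /mkseq /= !big_cons !big_nil !mulr1 => ->.
by rewrite [T s + _]addrC [T s * T t + _]addrC.
Qed.

Lemma rinvB s h h' : rinv s h -> rinv s h' -> rinv s (h - h').
Proof.
by move=> E E'; rewrite /rinv mulrBl (E : h * C s = _) (E' : h' * C s = _) scalerBr.
Qed.

Lemma rinv_mulC s h : rinv s (h * C s).
Proof. by rewrite /rinv -mulrA C_sqr scalerAr. Qed.

Lemma rinv_far s t h : ~~ e s t -> rinv s h -> rinv s (h * C t).
Proof.
move=> est E.
by rewrite /rinv -mulrA -C_comm // mulrA (E : h * C s = _) -scalerAl.
Qed.

(** Put y = g' C_s - f.  Then y C_t - g' = g' (C_s C_t - 1) - f C_t, and the braid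
    relation for the C_s turns a further factor C_s into v + v^-1. *)
Lemma rinv_braid s t g' f : s != t -> e s t -> rinv s f -> rinv t f -> rinv t g' ->
  rinv s ((g' * C s - f) * C t - g').
Proof.
move=> st est fs ft gt; have br : C s * C t * C s = C t * C s * C t - C t + C s.
  by rewrite -C_braid // subrK.
rewrite /rinv !mulrBl -[g' * C s * C t]mulrA -[g' * _ * C s]mulrA br.
rewrite (ft : f * C t = _) -scalerAl (fs : f * C s = _) mulrDr mulrBr addrAC addrK.
rewrite !mulrA (gt : g' * C t = _) -!scalerAl !scalerBr.
by rewrite addrAC.
Qed.

Lemma linv_mulC s t h : linv s h -> linv s (h * C t).
Proof. by move=> E; rewrite /linv mulrA (E : C s * h = _) -scalerAl. Qed.

Lemma linvB s h h' : linv s h -> linv s h' -> linv s (h - h').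
Proof.
by move=> E E'; rewrite /linv mulrBr (E : C s * h = _) (E' : C s * h' = _) scalerBr.
Qed.

(** ** Chains of elements with a single ascent *)

Definition KLp w y : {poly int} := KL_poly bar y w.
Definition hasKL w := KL_coefs w (KLp w).
Definition KLelt w : H := plin (KLp w).

Lemma hasKL_coefs w p : KL_coefs w p -> hasKL w /\ KLp w = p.
Proof.
move=> pP; have E : KLp w = p.
  by apply/funext=> y; apply: (KL_polyE pP).
by split=> //; rewrite /hasKL E.
Qed.

(** KL_step with A the generators other than j: an element with the descent j and
    without ascents in A is the longest element, which does not lie below w.  No
    term w k has the descent j if the dominant weight a, moved by w k, is positive
    at j. *)
Theorem KL_chain_step w j a (K : seq S) :
  hasKL w -> (forall k, k != j -> rinv k (KLelt w)) ->
  (forall s, 0 <= a s) -> 0 < wact w a j -> uniq K ->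
  (forall k, k \in K -> [/\ k != j, hasKL (w * g k)%g & rinv j (KLelt (w * g k)%g)]) ->
  (forall k, k != j -> k \notin K ->
     0 < wact w a j + (if e k j then wact w a k else 0)) ->
  [/\ hasKL (w * g j)%g, KLelt (w * g j)%g = KLelt w * C j - \sum_(k <- K) KLelt (w * g k)%g
    & len (w * g j)%g = (len w).+1].
Proof.
move=> wP winv a0 wj uK KP noK; have ndj := asc_wact a0 wj.
have lwj := length_asc m_diag ndj.
have [|||p' pP' pE] := KL_step
    (A := predC1 j) (P := fun k => KLp (w * g k)%g) wP ndj winv _ uK.
- move=> y py yj; have [[k [kj yk]]|no] := pselect (exists k, k != j /\ ~~ desc y k).
    by exists k.
  have yE : y = longest W.
    apply: (longest_uniq m_diag) => s; apply: contraT => ys.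
    case: no; exists s; split=> //.
    by apply: contraNneq ys => ->.
  have [_ _ ps _] := wP; have le_yw : le y w by apply: contraNT py => /ps->.
  have := bruhat_length_le le_yw; rewrite yE.
  by have := length_longest (w * g j)%g; lia.
- move=> k kK; have [kj kP kinv] := KP k kK; split=> //.
  exact: (KL_desc kP kinv).
- move=> k kj; apply: contraLR => kK.
  have := noK k kj kK; rewrite /= => pos.
  apply: (asc_wact a0 (_ : 0 < wact (w * g k)%g a j)).
  rewrite wactS /fire eq_sym (negPf kj).
  by case: (e k j) pos; rewrite ?addr0.
have [P'P P'E] := hasKL_coefs pP'; split=> //.
by rewrite /KLelt P'E pE.
Qed.

Lemma KLp_step w j w' (r : W -> {poly int}) : hasKL w -> ~~ desc w j ->
  KLelt w' = KLelt w * C j - plin r -> forall y, KLp w' y = mulC (KLp w) j y - r y.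
Proof.
move=> wP wj; have [_ p0 _ _] := wP.
rewrite /KLelt plin_mulC; last first.
  by move=> y yj; apply: p0; apply: contraNneq wj => <-.
rewrite -[- plin _]scaleN1r linZ linD => E y.
have {}E : plin (KLp w') = plin (fun y => mulC (KLp w) j y - r y).
  by rewrite E; congr lin; apply/funext=> z; rewrite rmorphB mulN1r.
exact: (plin_inj E).
Qed.

Lemma KLp_step_support w j w' (r : W -> {poly int}) : hasKL w -> ~~ desc w j ->
  KLelt w' = KLelt w * C j - plin r -> forall y, KLp w' y != 0 ->
  [|| KLp w y != 0, KLp w (y * g j)%g != 0 | r y != 0].
Proof.
move=> wP wj E y; rewrite (KLp_step wP wj E).
apply: contraR; rewrite !negb_or !negbK => /and3P[/eqP p0 /eqP p1 /eqP r0].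
rewrite r0 subr0 /mulC p0 p1 mulr0 !add0r.
by case: ifP => _ //; apply/eqP/polyP=> i; rewrite coef_drop_poly !coef0.
Qed.

(** Left invariance under j gives p_1 = v p_j, so the coefficient p_j + v p_1 of
    the product is (v + v^-1) p_1. *)
Lemma KLp1_step w j w' (r : W -> {poly int}) : hasKL w -> ~~ desc w j -> linv j (KLelt w) ->
  KLelt w' = KLelt w * C j - plin r ->
  'X * KLp w' 1%g = ('X^2 + 1) * KLp w 1%g - 'X * r 1%g.
Proof.
move=> wP wj jinv E; rewrite (KLp_step wP wj E).
rewrite mulrBr /mulC /desc length1 ltn0 mul1g mulrDr mulrA -expr2.
have := linv_plin jinv (y := 1%g).
rewrite mulg1 invg1 /desc length1 ltn0 => /(_ isT) <-.
by rewrite mulrDl mul1r.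
Qed.

End SimplyLaced.

(** * Type D: chains of Kazhdan-Lusztig elements *)

Lemma adjD_sym n : symmetric (@adjD n).
Proof. by move=> [a|] [b|] //=; rewrite orbC. Qed.

Lemma coxD_simply_laced n : simply_laced (@adjD n) (@coxD n).
Proof.
split=> [|s|s t /negPf st]; [exact: adjD_sym|by rewrite /coxD eqxx|].
by rewrite /coxD st.
Qed.

Section TypeD.
Local Open Scope ring_scope.
Variable n : nat.
Hypothesis n_ge2 : (2 <= n)%N.

Local Notation sl := (@coxD_simply_laced n).
Local Notation m_diag := (sl_diag sl).

(** The node 0^+ counts as the node 0 of the arm 1, ..., n. *)
Definition nd (k : nat) : nodeD n := Some (inord k).

Lemma nd_val (i : 'I_n.+1) : Some i = nd i.
Proof. by rewrite /nd inord_val. Qed.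

Lemma nodeD_cases (s : nodeD n) : s = None \/ exists2 k, (k <= n)%N & s = nd k.
Proof.
case: s => [i|]; [right|by left].
by exists i; [rewrite -ltnS|rewrite nd_val].
Qed.

Lemma nd_eq k l : (k <= n)%N -> (l <= n)%N -> (nd k == nd l) = (k == l).
Proof.
move=> kn ln; rewrite /nd -[_ == _]/(inord k == inord l).
by rewrite -val_eqE /= !inordK.
Qed.

Lemma adjD_nd k l : (k <= n)%N -> (l <= n)%N ->
  adjD (nd k) (nd l) = (k.+1 == l) || (l.+1 == k).
Proof. by move=> kn ln; rewrite /= !inordK. Qed.

Lemma adjD_ndN k : (k <= n)%N -> adjD (nd k) None = (k == 1%N).
Proof. by move=> kn; rewrite /= inordK. Qed.

Lemma adjD_Nnd k : (k <= n)%N -> adjD None (nd k) = (k == 1%N).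
Proof. by move=> kn; rewrite /= inordK. Qed.

Variables (W : coxeter_system (@coxD n)) (H : hecke_algebra (@coxD n)).
Variables (bar : {rmorphism H -> H}).
Hypothesis hbar : is_bar bar.
Implicit Types (s t : nodeD n) (w x y : W) (a : nodeD n -> int).

Local Notation g := (cox_gen W).
Local Notation len := (@cox_length _ _ W).
Local Notation word := (word_prod W).
Local Notation desc := (@desc _ _ W).
Local Notation plin := (@plin _ _ W H).
Local Notation C := (@hecke_C _ _ H).
Local Notation rinv := (@rinv _ _ H).
Local Notation linv := (@linv _ _ H).
Local Notation wact := (@wact _ _ _ sl W).
Local Notation KLp := (@KLp _ _ W H bar).
Local Notation hasKL := (@hasKL _ _ W H bar).
Local Notation KLelt := (@KLelt _ _ W H bar).

Lemma rinv0 s : rinv s 0.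
Proof. by rewrite /rinv mul0r scaler0. Qed.

Lemma fire_nd k l a : (k <= n)%N -> (l <= n)%N -> fire (@adjD n) (nd k) a (nd l) =
  if l == k then - a (nd k)
  else if (k.+1 == l) || (l.+1 == k) then a (nd l) + a (nd k) else a (nd l).
Proof. by move=> kn ln; rewrite /fire nd_eq // adjD_nd. Qed.

Lemma fire_ndN k a : (k <= n)%N -> fire (@adjD n) (nd k) a None =
  if k == 1%N then a None + a (nd k) else a None.
Proof. by move=> kn; rewrite /fire adjD_ndN. Qed.

(** ** Descending chains *)

Definition down d : seq (nodeD n) := [seq nd (n - k) | k <- iota 0 d].

Lemma word_down d : word (down d.+1) = (word (down d) * g (nd (n - d)))%g.
Proof. by rewrite /down -[d.+1]addn1 iotaD map_cat word_cat /= word_cons word_nil mulg1. Qed.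

(** A chain from n towards 1 that starts with an element w invariant on the right
    under all nodes but n.  The dominant weight a has a positive coordinate at n
    and zeros on the arm down to i. *)
Section Descent.
Variables (i : nat) (w : W) (a : nodeD n -> int).
Hypotheses (i_gt0 : (0 < i)%N) (i_le : (i <= n)%N).
Hypotheses (wP : hasKL w) (winv : forall s, s != nd n -> rinv s (KLelt w)).
Hypotheses (a_ge0 : forall s, 0 <= a s) (wn : 0 < wact w a (nd n)).
Hypothesis wk : forall k, (i <= k < n)%N -> wact w a (nd k) = 0.

Definition descent d : W := (w * word (down d))%g.
Local Notation U := descent.

Lemma descentS d : U d.+1 = (U d * g (nd (n - d)))%g.
Proof. by rewrite /descent word_down mulgA. Qed.

Definition descent_prev d : H := if d is d'.+1 then KLelt (U d') else 0.

(** The steps move the positive coordinate along the arm and leave its opposite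
    one node behind. *)
Lemma descent_weight d : (d <= n - i)%N ->
  [/\ wact (U d) a (nd (n - d)) = wact w a (nd n),
    forall k, (k < n - d)%N -> wact (U d) a (nd k) = wact w a (nd k),
    forall k, (n - d < k <= n)%N -> wact (U d) a (nd k) =
      if k == (n - d).+1 then - wact w a (nd n) else 0 &
    wact (U d) a None = wact w a None].
Proof.
elim: d => [|d IH] dn.
  rewrite /descent /down word_nil mulg1 subn0; split=> // k; lia.
have [IH1 IH2 IH4 IH3] := IH (ltnW dn); have le_nd : (n - d <= n)%N by lia.
have w0 : wact w a (nd (n - d.+1)) = 0 by apply: wk; lia.
rewrite descentS !wactS; split=> [|k lk|k lk|].
- rewrite fire_nd //; last by lia.
  rewrite ifN; last by lia.
  rewrite ifT; last by lia.
  by rewrite IH1 IH2 ?w0 ?add0r //; lia.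
- rewrite fire_nd //; last by lia.
  rewrite ifN; last by lia.
  rewrite ifN; last by lia.
  by apply: IH2; lia.
- rewrite fire_nd //; last by lia.
  case: eqVneq => [kE|kE]; first by rewrite IH1 ifT //; lia.
  rewrite IH4; last by lia.
  rewrite IH1 [in RHS]ifN; last by lia.
  have [kE'|kE'] := eqVneq k (n - d).+1; first by rewrite addNr.
  by rewrite ifN //=; lia.
- by rewrite fire_ndN // ifN //; lia.
Qed.

Definition descent_spec d :=
  hasKL (U d) /\ forall s, s != nd (n - d) -> rinv s (KLelt (U d)).

Lemma descent_prev_inv d s : (d <= n)%N ->
  (forall d', (d' < d)%N -> descent_spec d') ->
  s != nd (n - d.-1) -> rinv s (descent_prev d).
Proof. by case: d => [|d] _ sp sd; [apply: rinv0|apply: (sp d _).2]. Qed.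

Lemma descent_step d : (d < n - i)%N -> (forall d', (d' <= d)%N -> descent_spec d') ->
  [/\ hasKL (U d.+1),
    KLelt (U d.+1) = KLelt (U d) * C (nd (n - d)) - descent_prev d &
    len (U d.+1) = (len (U d)).+1].
Proof.
move=> dn sp; have [Ud Uinv] := sp d (leqnn d).
have [wd wk' _ wN] := descent_weight (ltnW dn).
(* Only the last letter, which leads back to the preceding element, can give a
   term of the correction. *)
pose K := if d is d'.+1 then [:: nd (n - d')] else [::].
have lt_n : (n - d <= n)%N by lia.
have Kd k : k \in K -> exists2 d', d = d'.+1 & k = nd (n - d').
  by rewrite /K; case: (d) => // d'; rewrite inE => /eqP->; exists d'.
have UK d' : d = d'.+1 -> (U d * g (nd (n - d')))%g = U d'.
  by move=> ->; rewrite descentS genK //; apply: m_diag.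
have -> : descent_prev d = \sum_(k <- K) KLelt (U d * g k)%g.
  rewrite /K /descent_prev; case: (d) UK => [|d'] UK; first by rewrite big_nil.
  by rewrite big_seq1 UK.
rewrite descentS; apply: (KL_chain_step (sl := sl) hbar Ud Uinv a_ge0 (K := K)).
- by rewrite wd.
- by rewrite /K; case: (d).
- move=> k /Kd[d' dE ->]; rewrite UK //; have [Ud' inv'] := sp d' ltac:(lia).
  have neq : nd (n - d') != nd (n - d) by rewrite nd_eq //; lia.
  by split=> //; apply: inv'; rewrite eq_sym.
- move=> k kd kK; rewrite wd; case: ifP => adj; last by rewrite addr0.
  have [kE|[l ln kE]] := nodeD_cases k.
    by move: adj; rewrite kE adjD_Nnd // => /eqP; lia.
  move: adj kd kK; rewrite kE adjD_nd // nd_eq // => adj kd kK.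
  have [lE|lE] := eqVneq l.+1 (n - d)%N.
    have w0 : wact w a (nd l) = 0 by apply: wk; lia.
    by rewrite wk' ?w0 ?addr0 //; lia.
  case/negP: kK; have [d' dE] : exists d', d = d'.+1 by exists d.-1; lia.
  rewrite /K dE mem_seq1 nd_eq //; lia.
Qed.

(** Invariance of the new element: under the new letter since that is a factor,
    under the preceding letter by the braid relation, and under the other nodes
    since they commute with the new letter. *)
Lemma descentP D : (D <= n - i)%N ->
  (forall d, (d <= D)%N -> descent_spec d) /\
  (forall d, (d < D)%N ->
    KLelt (U d.+1) = KLelt (U d) * C (nd (n - d)) - descent_prev d /\
    len (U d.+1) = (len (U d)).+1).
Proof.
elim: D => [|D IH] Dn.
  split=> // d; rewrite leqn0 => /eqP->; rewrite /descent_spec /descent subn0.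
  by rewrite /down word_nil mulg1.
have [sp rel] := IH (ltnW Dn).
have [UD hE lE] := descent_step Dn sp.
split=> d; last first.
  rewrite ltnS leq_eqVlt => /predU1P[->|]; [by []|exact: rel].
rewrite leq_eqVlt => /predU1P[->|]; last by apply: sp.
split=> // s sD; rewrite hE.
have le_n : (n - D <= n)%N by lia.
have [Dd Dinv] := sp D (leqnn D).
have inv_prev t : t != nd (n - D.-1) -> rinv t (descent_prev D).
  by apply: descent_prev_inv => [|d' d'D]; [lia|apply: sp; lia].
have [->|st] := eqVneq s (nd (n - D)).
  have [->|D0] := eqVneq D 0%N.
    by apply: rinvB; [apply: rinv_mulC|apply: rinv0].
  apply: rinvB; [apply: rinv_mulC|apply: inv_prev].
  by rewrite nd_eq //; lia.
have [sE|sp'] := boolP ((0 < D)%N && (s == nd (n - D.-1))).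
  case/andP: sE => D0 /eqP sE.
  have [D' DE] : exists D', D = D'.+1 by exists D.-1; lia.
  have := (rel D' ltac:(lia)).1; rewrite DE /= in sE *; rewrite -sE => ->.
  have adj : adjD s (nd (n - D'.+1)) by rewrite sE adjD_nd //; lia.
  have [_ inv'] := sp D' ltac:(lia).
  have inv2 t : t != nd (n - D'.-1) -> rinv t (descent_prev D').
    by apply: descent_prev_inv => [|d' d'D]; [lia|apply: sp; lia].
  have f_inv t : t != nd (n - D'.-1) \/ D' = 0%N -> rinv t (descent_prev D').
    by case=> [/inv2 //|->]; apply: rinv0.
  have neq : (n - D' == n - D'.+1)%N = false by lia.
  apply: (rinv_braid sl _ adj).
  - by rewrite sE nd_eq ?neq //; lia.
  - apply: f_inv; rewrite sE; have [->|D'0] := eqVneq D' 0%N; [by right|left].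
    by rewrite nd_eq //; lia.
  - apply: f_inv; have [->|D'0] := eqVneq D' 0%N; [by right|left].
    by rewrite nd_eq //; lia.
  - by apply: inv'; rewrite nd_eq //; lia.
have far : ~~ adjD s (nd (n - D)).
  have [sE|[l ln sE]] := nodeD_cases s; first by rewrite sE adjD_Nnd //; lia.
  move: sD st sp'; rewrite sE adjD_nd // !nd_eq //; lia.
apply: rinvB.
  apply: (rinv_far sl far); exact: Dinv.
case: (D) sp' inv_prev => [|k] sp' inv_prev; first exact: rinv0.
exact: inv_prev.
Qed.

Lemma descent_linv s d : linv s (KLelt w) -> (d <= n - i)%N -> linv s (KLelt (U d)).
Proof.
move=> ws; elim/ltn_ind: d => -[|d] IH dn.
  by rewrite /descent /down word_nil mulg1.
have [_ /(_ d (leqnn _))[-> _]] := descentP dn.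
apply: linvB; first by apply: linv_mulC; apply: IH; lia.
case: d IH dn => [|d] IH dn; last by apply: IH; lia.
by rewrite /linv /= mulr0 scaler0.
Qed.

End Descent.

(** The fundamental weight of the node k. *)
Definition omega (k : nat) : nodeD n -> int := fun s => (s == nd k)%:Z.

Lemma omega_ge0 k s : 0 <= omega k s.
Proof. by rewrite /omega; case: eqP. Qed.

Lemma fire_id s a : a s = 0 -> fire (@adjD n) s a = a.
Proof.
move=> as0; apply/funext=> t; rewrite /fire as0 oppr0 addr0 if_same.
by case: eqVneq => // ->.
Qed.

Lemma wact_parabolic (J : pred (nodeD n)) a w :
  (forall s, J s -> a s = 0) -> parabolic J w -> wact w a = a.
Proof.
move=> aJ /parabolicP[u Ju <-]; elim/last_ind: u Ju => [|u s IH].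
  by rewrite word_nil wact1.
by rewrite all_rcons word_rcons wactS => /andP[/aJ as0 /IH->]; rewrite fire_id.
Qed.

(** ** The fork *)

Section Fork.

Let J : pred (nodeD n) := fun s => s != nd n.

(* The properties of the longest element of the parabolic subgroup of J. *)
Variable w : W.
Hypothesis wP : hasKL w.
Hypothesis winv : forall s, s != nd n -> rinv s (KLelt w).
Hypothesis wlinv : forall s, s != nd n -> linv s (KLelt w).
Hypothesis wJ : parabolic J w.
Hypothesis wsupp : forall y, KLp w y != 0 -> parabolic J y.
Hypothesis w1 : KLp w 1%g = 'X^(len w).

Local Notation U := (descent w).
Local Notation a := (omega n).

Lemma wact_w : wact w a = a.
Proof. by apply: wact_parabolic wJ => s; rewrite /J /omega => /negPf->. Qed.

Let a_n : a (nd n) = 1.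
Proof. by rewrite /omega eqxx. Qed.

Let a_lt k : (k < n)%N -> a (nd k) = 0.
Proof. by move=> kn; rewrite /omega nd_eq // ?ltn_eqF // ltnW. Qed.

Lemma fork_chain :
  (forall d, (d < n)%N -> descent_spec w d) /\
  (forall d, (d.+1 < n)%N ->
    KLelt (U d.+1) = KLelt (U d) * C (nd (n - d)) - descent_prev w d /\
    len (U d.+1) = (len (U d)).+1).
Proof.
have wn : 0 < wact w a (nd n) by rewrite wact_w a_n.
have wk k : (1 <= k < n)%N -> wact w a (nd k) = 0.
  by move=> kn; rewrite wact_w a_lt //; lia.
have [sp rel] := descentP (isT : (0 < 1)%N) (ltnW n_ge2) wP winv (omega_ge0 n) wn wk (leqnn (n - 1)).
by split=> [d dn|d dn]; [apply: sp; lia|apply: rel; lia].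
Qed.

Lemma fork_weight d : (d < n)%N ->
  [/\ wact (U d) a (nd (n - d)) = 1,
    forall k, (k < n - d)%N -> wact (U d) a (nd k) = 0,
    forall k, (n - d < k <= n)%N -> wact (U d) a (nd k) =
      if k == (n - d).+1 then - 1 else 0 &
    wact (U d) a None = 0].
Proof.
move=> dn; have wn : 0 < wact w a (nd n) by rewrite wact_w a_n.
have wk k : (1 <= k < n)%N -> wact w a (nd k) = 0.
  by move=> kn; rewrite wact_w a_lt //; lia.
have dn1 : (d <= n - 1)%N by lia.
have [E1 E2 E4 E3] := descent_weight (isT : (0 < 1)%N) (ltnW n_ge2) wn wk dn1.
rewrite wact_w a_n in E1 E4; split=> // [k lk|]; last by rewrite E3 wact_w.
by rewrite E2 // wact_w a_lt //; lia.
Qed.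

(** The step at the trivalent node creates two ascents, 0^+ and 0^-. *)
Lemma fork_node :
  [/\ hasKL (U n), KLelt (U n) = KLelt (U n.-1) * C (nd 1) - KLelt (U n.-2),
    len (U n) = (len (U n.-1)).+1 &
    forall s, s != nd 0 -> s != None -> rinv s (KLelt (U n))].
Proof.
have [sp rel] := fork_chain.
have [Ud Uinv] := sp n.-1 ltac:(lia); have [Ue Einv] := sp n.-2 ltac:(lia).
have [wd wk' _ wN] := fork_weight (d := n.-1) ltac:(lia).
have n1 : (n - n.-1 = 1)%N by lia.
have n2 : (n - n.-2 = 2)%N by lia.
rewrite n1 in wd wk' Uinv; rewrite n2 in Einv.
have le1 : (1 <= n)%N by lia.
have UnE : U n = (U n.-1 * g (nd 1))%g.
  by have := descentS w n.-1; rewrite n1 prednK.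
have Un1E : U n.-1 = (U n.-2 * g (nd 2))%g.
  by have := descentS w n.-2; rewrite n2 (_ : n.-2.+1 = n.-1) //; lia.
have U2 : (U n.-1 * g (nd 2))%g = U n.-2.
  by rewrite Un1E genK //; apply: m_diag.
have [UP UE Ul] : [/\ hasKL (U n), KLelt (U n) = KLelt (U n.-1) * C (nd 1) - KLelt (U n.-2)
    & len (U n) = (len (U n.-1)).+1].
  have -> : KLelt (U n.-2) = \sum_(k <- [:: nd 2]) KLelt (U n.-1 * g k)%g.
    by rewrite big_seq1 U2.
  rewrite UnE; apply: (KL_chain_step (sl := sl) hbar Ud Uinv (omega_ge0 n)) => //.
  - by rewrite wd.
  - move=> k; rewrite inE => /eqP->; rewrite U2 nd_eq //; split=> //.
    by apply: Einv; rewrite nd_eq.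
  - move=> k k1; rewrite inE wd => k2; case: ifP => adj; last by rewrite addr0.
    have [->|[l ln kE]] := nodeD_cases k; first by rewrite wN.
    move: k1 k2 adj; rewrite kE !nd_eq // adjD_nd // => k1 k2 adj.
    by rewrite wk' //; lia.
split=> // s s0 sN; rewrite UE.
have [->|s1] := eqVneq s (nd 1).
  by apply: rinvB; [apply: rinv_mulC|apply: Einv; rewrite nd_eq].
have [->|s2] := eqVneq s (nd 2).
  have := (rel n.-2 ltac:(lia)).1; rewrite n2 (_ : n.-2.+1 = n.-1); last by lia.
  move=> ->; have adj : adjD (nd 2) (nd 1) by rewrite adjD_nd.
  (* For n = 2 the chain starts next to the trivalent node, and the term is 0. *)
  have prev_inv t : t != nd 3 \/ n = 2%N -> rinv t (descent_prev w n.-2).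
    case: (eqVneq n 2%N) => [n2E _|/eqP n2E [t3|/n2E//]].
      by rewrite (_ : n.-2 = 0%N) ?n2E //; apply: rinv0.
    apply: descent_prev_inv => [|d dn|]; [lia|apply: sp; lia|].
    by rewrite (_ : (n - n.-2.-1 = 3)%N) //; lia.
  have prev_inv' k : (k < 3)%N -> rinv (nd k) (descent_prev w n.-2).
    move=> k3; apply: prev_inv; have [n2E|n3] := eqVneq n 2%N; [by right|left].
    by rewrite nd_eq //; lia.
  apply: (rinv_braid sl _ adj); rewrite ?nd_eq //.
  - exact: prev_inv'.
  - exact: prev_inv'.
  - by apply: Einv; rewrite nd_eq.
have far : ~~ adjD s (nd 1).
  have [sE|[l ln sE]] := nodeD_cases s; first by rewrite sE in sN.
  by move: s0 s1 s2; rewrite sE adjD_nd // !nd_eq //; lia.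
apply: rinvB; first by apply: (rinv_far sl far); apply: Uinv.
exact: Einv.
Qed.

Lemma fork_nodeE : U n = (U n.-1 * g (nd 1))%g.
Proof.
have n1 : (n - n.-1 = 1)%N by lia.
have le1 : (0 < n)%N by lia.
by have := descentS w n.-1; rewrite n1 (prednK le1).
Qed.

Lemma fork_node_weight :
  [/\ wact (U n) a (nd 0) = 1, wact (U n) a None = 1, wact (U n) a (nd 1) = - 1 &
    forall k, (1 < k <= n)%N -> wact (U n) a (nd k) = 0].
Proof.
have [wd wk' wl wN] := fork_weight (d := n.-1) ltac:(lia).
have n1 : (n - n.-1 = 1)%N by lia.
rewrite n1 in wd wk' wl; rewrite fork_nodeE wactS; split=> [|||k lk].
- by rewrite fire_nd; [rewrite /= (wk' 0%N isT) wd add0r|lia|lia].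
- by rewrite fire_ndN; [rewrite /= wN wd add0r|lia].
- by rewrite fire_nd; [rewrite /= wd|lia|lia].
- rewrite fire_nd //; [|lia|lia].
  rewrite (wl k lk) wd; case: eqVneq => [kE|k1]; first by lia.
  have [kE|k2] := eqVneq k 2%N; first by rewrite addNr.
  by rewrite ifN //=; lia.
Qed.

Definition prev_coef d y : {poly int} := if d is d'.+1 then KLp (U d') y else 0.

Lemma plin_prev_coef d : plin (prev_coef d) = descent_prev w d.
Proof.
case: d => //; rewrite /plin /lin big1 // => y _.
by rewrite rmorph0 scale0r.
Qed.

Lemma fork_rel d : (d < n)%N ->
  [/\ hasKL (U d), KLelt (U d.+1) = KLelt (U d) * C (nd (n - d)) - plin (prev_coef d) &
    len (U d.+1) = (len (U d)).+1].
Proof.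
move=> dn; rewrite plin_prev_coef; have [sp rel] := fork_chain.
split; first exact: (sp d dn).1.
  have [dn'|dn'] := ltnP d.+1 n; first by have [] := rel d dn'.
  have [_ + _ _] := fork_node; have dE : d = n.-1 by lia.
  have nE : d.+1 = n by lia.
  rewrite nE dE (_ : n - n.-1 = 1)%N; last by lia.
  by rewrite -[n.-1](_ : n.-2.+1 = _) //; lia.
have [dn'|dn'] := ltnP d.+1 n; first by have [] := rel d dn'.
have [_ _ + _] := fork_node; have dE : d = n.-1 by lia.
have nE : d.+1 = n by lia.
by rewrite nE dE.
Qed.

(** After the trivalent node there are two ascents, and KL_step needs an ascent
    among the other nodes.  By this lemma it can be read off from the weight. *)
Lemma fork_support d : (d <= n)%N -> forall y, KLp (U d) y != 0 ->
  exists2 r, (r <= d)%N & wact y a = wact (U r) a.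
Proof.
elim/ltn_ind: d => -[|d] IH dn y py.
  exists 0%N => //; rewrite /descent /down word_nil mulg1 wact_w.
  apply: (@wact_parabolic J) => [s|]; first by rewrite /J /omega => /negPf->.
  by apply: wsupp; rewrite /descent /down word_nil mulg1 in py.
have [UP hE lE] := fork_rel dn.
have Uasc : ~~ desc (U d) (nd (n - d)).
  by rewrite /desc -descentS lE -leqNgt ltnW.
case/or3P: (KLp_step_support sl UP Uasc hE py).
- by case/(IH d (leqnn _) (ltnW dn)) => r rd ->; exists r => //; lia.
- case/(IH d (leqnn _) (ltnW dn)) => r rd E.
  have {}E : wact y a = fire (@adjD n) (nd (n - d)) (wact (U r) a).
    by rewrite -E wactS fire_invol.
  have [rE|rE] := eqVneq r d; first by exists d.+1; rewrite // E rE descentS wactS.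
  exists r; first by lia.
  rewrite E fire_id //; have [_ + _ _] := fork_weight (d := r) ltac:(lia).
  by apply; lia.
- rewrite /prev_coef; case: d IH dn {UP hE lE Uasc py} => [|d] IH dn; first by rewrite eqxx.
  by case/(IH d (leqW (leqnn _)) (ltnW (ltnW dn))) => r rd ->; exists r => //; lia.
Qed.

(** Indexed by booleans, so that negation is the symmetry of 0^+ and 0^-. *)
Definition tip (b : bool) : nodeD n := if b then nd 0 else None.

Let le1n : (1 <= n)%N. Proof. by lia. Qed.

Lemma tip_adj b k : adjD k (tip b) = (k == nd 1).
Proof.
have [->|[l ln ->]] := nodeD_cases k; first by case: b; rewrite ?adjD_Nnd.
case: b; first by rewrite adjD_nd // nd_eq //; lia.
by rewrite adjD_ndN // nd_eq.
Qed.

Lemma adj_tip b k : adjD (tip b) k = (k == nd 1).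
Proof. by rewrite adjD_sym tip_adj. Qed.

Lemma tip_neq b k : (0 < k <= n)%N -> (tip b == nd k) = false.
Proof. by case: b => [kn|//]; rewrite nd_eq //; lia. Qed.

Lemma tip_negb b : (tip b == tip (~~ b)) = false.
Proof. by case: b. Qed.

Lemma tip_comm b : (g (tip b) * g (tip (~~ b)) = g (tip (~~ b)) * g (tip b))%g.
Proof.
apply: (gen_comm sl).
by rewrite tip_adj tip_neq.
Qed.

Lemma not_tip b s : s != tip b -> s != tip (~~ b) -> exists2 k, (0 < k <= n)%N & s = nd k.
Proof.
have [->|[[|k] kn ->]] := nodeD_cases s; first by case: b.
  by case: b; rewrite eqxx.
by exists k.+1.
Qed.

Lemma fork_node_tip b : wact (U n) a (tip b) = 1.
Proof. by have [? ? _ _] := fork_node_weight; case: b. Qed.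

Lemma fork_node_inv s : s != tip true -> s != tip false -> rinv s (KLelt (U n)).
Proof. by have [_ _ _ inv] := fork_node; apply: inv. Qed.

Definition arm b : W := (U n * g (tip b))%g.

Lemma armP b :
  [/\ hasKL (arm b), KLelt (arm b) = KLelt (U n) * C (tip b) - KLelt (U n.-1),
    len (arm b) = (len (U n)).+1 &
    forall s, s != tip (~~ b) -> rinv s (KLelt (arm b))].
Proof.
have [UP UE _ _] := fork_node; have [wt0 wtN wt1 wtk] := fork_node_weight.
have [sp _] := fork_chain; have [Ud Uinv] := sp n.-1 ltac:(lia).
have n1 : (n - n.-1 = 1)%N by lia.
rewrite n1 in Uinv.
have wb : 0 < wact (U n) a (tip b) by rewrite fork_node_tip.
have asc := asc_wact (omega_ge0 n) wb.
have U1 : (U n * g (nd 1))%g = U n.-1.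
  by rewrite fork_nodeE genK //; apply: m_diag.
pose A : pred (nodeD n) := fun s => (s != tip true) && (s != tip false).
have Atip s : A s -> s != tip b by case: b {wb asc} => /andP[].
have [|||||p' pP' pE] := KL_step sl hbar
    (A := A) (K := [:: nd 1]) (P := fun k => KLp (U n * g k)%g) UP asc.
- by move=> s /andP[s0 sN]; apply: fork_node_inv.
- move=> y py yj; have [r rn E] := fork_support (leqnn n) py.
  have [rE|rn'] := eqVneq r n.
    have := wact_desc sl (omega_ge0 n) yj.
    by rewrite E rE fork_node_tip.
  have [wr _ _ _] := fork_weight (d := r) ltac:(lia).
  exists (nd (n - r)).
    by rewrite /A ![nd _ == tip _]eq_sym !tip_neq //; lia.
  by apply: (asc_wact (omega_ge0 n) (_ : 0 < wact y a _)); rewrite E wr.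
- by [].
- move=> k; rewrite inE => /eqP->; rewrite U1; split=> //.
    by rewrite /A ![nd _ == tip _]eq_sym !tip_neq.
  apply: (KL_desc sl Ud).
  by apply: Uinv; rewrite tip_neq.
- move=> k Ak; rewrite inE; apply: contraLR => k1.
  apply: (asc_wact (omega_ge0 n) (_ : 0 < wact (U n * g k)%g a _)).
  by rewrite wactS fire_far ?fork_node_tip ?tip_adj // eq_sym Atip.
have [P'P P'E] := hasKL_coefs sl hbar pP'.
have hE : KLelt (arm b) = KLelt (U n) * C (tip b) - KLelt (U n.-1).
  by rewrite /KLelt P'E pE big_seq1 U1.
split=> //; first by rewrite /arm (length_asc m_diag asc).
move=> s sb; rewrite hE.
have [->|sb'] := eqVneq s (tip b).
  by apply: rinvB; [apply: rinv_mulC|apply: Uinv; rewrite tip_neq].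
have sA : rinv s (KLelt (U n)) by apply: fork_node_inv; case: b sb sb' {hE wb asc Atip P'P P'E pP' pE}.
have [sE|s1] := eqVneq s (nd 1); last first.
  apply: rinvB; last exact: Uinv.
  by apply: (rinv_far sl) => //; rewrite tip_adj.
have [sp2 inv2] := sp n.-2 ltac:(lia).
have n2 : (n - n.-2 = 2)%N by lia.
rewrite n2 in inv2; rewrite UE sE.
apply: (rinv_braid sl).
- by rewrite eq_sym tip_neq.
- by rewrite tip_adj.
- by apply: inv2; rewrite nd_eq.
- by apply: inv2; rewrite tip_neq.
- by apply: Uinv; rewrite tip_neq.
Qed.

Lemma arm_weight b :
  [/\ wact (arm b) a (tip (~~ b)) = 1, wact (arm b) a (nd 1) = 0 &
    forall k, (1 < k <= n)%N -> wact (arm b) a (nd k) = 0].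
Proof.
have [_ _ wt1 wtk] := fork_node_weight.
rewrite /arm wactS; split=> [||k kn].
- rewrite fire_far ?fork_node_tip // ?adj_tip ?tip_neq //.
  by rewrite eq_sym tip_negb.
- by rewrite fire_adj ?adj_tip // ?wt1 ?fork_node_tip // eq_sym tip_neq.
- by rewrite fire_far ?wtk ?adj_tip ?nd_eq // 1?eq_sym ?tip_neq //; lia.
Qed.

(** ** The ascending chain *)

Definition seg i d : seq (nodeD n) := [seq nd (i + l) | l <- iota 0 d].

Lemma word_seg i d : word (seg i d.+1) = (word (seg i d) * g (nd (i + d)))%g.
Proof. by rewrite /seg -[d.+1]addn1 iotaD map_cat word_cat /= word_cons word_nil mulg1. Qed.

Definition ascent k : W := (arm true * g (tip false) * word (seg 1 k))%g.
Local Notation V := ascent.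

Lemma ascentS k : V k.+1 = (V k * g (nd k.+1))%g.
Proof. by rewrite /ascent word_seg mulgA. Qed.

Lemma ascent0 b : V 0 = (arm b * g (tip (~~ b)))%g.
Proof.
rewrite /ascent /seg word_nil mulg1; case: b => //.
by rewrite /arm -!mulgA (tip_comm true).
Qed.

(** Both arms of the fork precede its closing element V 0: the sum of their
    elements is the correction at the step from V 0. *)
Definition ascent_prev k y : {poly int} :=
  if k is k'.+1 then KLp (V k') y else KLp (arm true) y + KLp (arm false) y.

Definition ascent_spec k := hasKL (V k) /\
  forall s, ((k < n)%N -> s != nd k.+1) -> rinv s (KLelt (V k)).

Lemma ascent_weight k : (k < n)%N ->
  wact (V k) a (nd k.+1) = 1 /\
  forall l, (k.+1 < l <= n)%N -> wact (V k) a (nd l) = 0.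
Proof.
elim: k => [|k IH] kn.
  have [wt w1' wk] := arm_weight true; rewrite (ascent0 true) wactS; split=> [|l ln].
    by rewrite fire_adj ?adj_tip ?w1' ?wt ?add0r // eq_sym tip_neq.
  by rewrite fire_far ?wk ?adj_tip ?nd_eq // 1?eq_sym ?tip_neq //; lia.
have [IH1 IH2] := IH (ltnW kn); rewrite ascentS wactS; split=> [|l ln].
  rewrite fire_nd; [|lia|lia].
  rewrite ifN; last by lia.
  by rewrite ifT ?IH1 ?IH2 ?add0r //; lia.
rewrite fire_nd; [|lia|lia].
rewrite ifN; last by lia.
by rewrite ifN ?IH2 //; lia.
Qed.

Lemma plin_ascent_prev k : plin (ascent_prev k) =
  if k is k'.+1 then KLelt (V k') else KLelt (arm true) + KLelt (arm false).
Proof.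
case: k => // ; rewrite /KLelt /plin linD; congr lin.
by apply/funext=> y; rewrite rmorphD.
Qed.

Lemma ascent_start : ascent_spec 0 /\
  forall b, KLelt (V 0) = KLelt (arm b) * C (tip (~~ b)) /\ len (V 0) = (len (arm b)).+1.
Proof.
have st b : [/\ hasKL (V 0), KLelt (V 0) = KLelt (arm b) * C (tip (~~ b)) &
    len (V 0) = (len (arm b)).+1].
  have [AP AE _ Ainv] := armP b; have [wt w1' _] := arm_weight b.
  rewrite (ascent0 b); have -> : KLelt (arm b) * C (tip (~~ b)) =
      KLelt (arm b) * C (tip (~~ b)) - \sum_(k <- [::]) KLelt (arm b * g k)%g.
    by rewrite big_nil subr0.
  apply: (KL_chain_step (sl := sl) hbar AP Ainv (omega_ge0 n)) => //.
    by rewrite wt.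
  move=> k kb _; rewrite wt tip_adj; case: eqP => [->|_].
    by rewrite w1'.
  by rewrite addr0.
split=> [|b]; last by have [] := st b.
have [VP _ _] := st true; split=> // s /(_ ltac:(lia)) s1.
have tipP b : s = tip b -> rinv s (KLelt (V 0)).
  by move=> ->; have [_ -> _] := st (~~ b); rewrite negbK; apply: rinv_mulC.
have [/tipP//|st'] := eqVneq s (tip true).
have [/tipP//|sf] := eqVneq s (tip false).
have [_ -> _] := st true; have [_ _ _ Ainv] := armP true.
by apply: (rinv_far sl); [rewrite tip_adj|apply: Ainv].
Qed.

Lemma ascent_prev_inv k s : (k <= n)%N ->
  (forall l, (l < k)%N -> ascent_spec l) ->
  (if k == 0%N then exists2 l, (0 < l <= n)%N & s = nd l else s != nd k) ->
  rinv s (plin (ascent_prev k)).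
Proof.
move=> kn sp; rewrite plin_ascent_prev; case: k kn sp => [|k] kn sp /=.
  case=> l ln ->; have inv b : rinv (nd l) (KLelt (arm b)).
    by have [_ _ _ inv] := armP b; apply: inv; rewrite eq_sym tip_neq.
  rewrite /rinv mulrDl (inv true : KLelt _ * C _ = _) (inv false : KLelt _ * C _ = _).
  by rewrite scalerDr.
by move=> sk; apply: (sp k (leqnn _)).2 => _.
Qed.

Lemma ascent_step k : (k < n)%N -> (forall l, (l <= k)%N -> ascent_spec l) ->
  [/\ hasKL (V k.+1),
    KLelt (V k.+1) = KLelt (V k) * C (nd k.+1) - plin (ascent_prev k) &
    len (V k.+1) = (len (V k)).+1].
Proof.
move=> kn sp; have [VP Vinv] := sp k (leqnn k).
have {}Vinv s : s != nd k.+1 -> rinv s (KLelt (V k)) by move=> sk; apply: Vinv.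
have [wk wl] := ascent_weight kn.
pose K := if k is k'.+1 then [:: nd k] else [:: tip true; tip false].
have VK b : (V 0 * g (tip b))%g = arm (~~ b).
  by rewrite (ascent0 (~~ b)) negbK genK //; apply: m_diag.
have VK' k' : k = k'.+1 -> (V k * g (nd k))%g = V k'.
  by move=> ->; rewrite ascentS genK //; apply: m_diag.
have -> : plin (ascent_prev k) = \sum_(s <- K) KLelt (V k * g s)%g.
  rewrite plin_ascent_prev /K; case: (k) VK' => [|k'] VK'.
    by rewrite big_cons big_seq1 !VK /= addrC.
  by rewrite big_seq1 (VK' k' erefl).
rewrite ascentS; apply: (KL_chain_step (sl := sl) hbar VP Vinv (omega_ge0 n) (K := K)).
- by rewrite wk.
- by rewrite /K; case: (k).
- move=> s; rewrite /K; case: (k) VK' sp kn => [|k'] VK' sp kn.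
    have tipP b : [/\ tip b != nd 1, hasKL (V 0 * g (tip b))%g &
        rinv (nd 1) (KLelt (V 0 * g (tip b))%g)].
      rewrite VK tip_neq; last by lia.
      have [AP _ _ Ainv] := armP (~~ b); split=> //.
      by apply: Ainv; rewrite eq_sym tip_neq //; lia.
    by rewrite !inE => /orP[] /eqP->.
  rewrite inE => /eqP->; rewrite (VK' k' erefl); have [VP' Vinv'] := sp k' ltac:(lia).
  split=> //; first by rewrite nd_eq //; lia.
  by apply: Vinv' => _; rewrite nd_eq //; lia.
- move=> s sk sK; rewrite wk; case: ifP => adj; last by rewrite addr0.
  have tipsK b : s = tip b -> False.
    move=> sE; move: adj sK; rewrite sE adj_tip nd_eq //.
    by rewrite /K => /eqP[->]; rewrite !inE; case: (b); rewrite eqxx ?orbT.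
  have [st|st] := eqVneq s (tip true); first by case: (tipsK true).
  have [sf|sf] := eqVneq s (tip false); first by case: (tipsK false).
  have [l ln sE] := not_tip st sf.
  move: adj sk sK; rewrite sE adjD_nd ?nd_eq //; try lia; move=> adj lk lK.
  have [lE|lE] := eqVneq l k.+2; first by rewrite (wl l) //; lia.
  have lE' : l = k by lia.
  move: lK; rewrite lE' /K; case: (k) lE' => [lE'|k' _]; first by lia.
  by rewrite inE eqxx.
Qed.

Lemma ascentP k : (k <= n)%N ->
  (forall l, (l <= k)%N -> ascent_spec l) /\
  (forall l, (l < k)%N ->
    KLelt (V l.+1) = KLelt (V l) * C (nd l.+1) - plin (ascent_prev l) /\
    len (V l.+1) = (len (V l)).+1).
Proof.
elim: k => [|k IH] kn.
  by split=> // l; rewrite leqn0 => /eqP->; have [] := ascent_start.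
have [sp rel] := IH (ltnW kn); have [VP hE lE] := ascent_step kn sp.
split=> l; last by rewrite ltnS leq_eqVlt => /predU1P[->|]; [|apply: rel].
rewrite leq_eqVlt => /predU1P[->|]; last by apply: sp.
split=> // s sk; rewrite hE.
have [VkP Vinv] := sp k (leqnn k).
have prev_inv t : (if k == 0%N then exists2 l, (0 < l <= n)%N & t = nd l else t != nd k) ->
    rinv t (plin (ascent_prev k)).
  by apply: ascent_prev_inv => [|l' l'k]; [lia|apply: sp; lia].
have [->|sk1] := eqVneq s (nd k.+1).
  apply: rinvB; [exact: rinv_mulC|apply: prev_inv].
  by case: eqP => [->|_]; [exists 1%N|rewrite nd_eq //; lia].
have sV : rinv s (KLelt (V k)) by apply: Vinv.
have [tipk|notip] := boolP ((k == 0%N) && ((s == tip true) || (s == tip false))).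
  case/andP: tipk => /eqP k0 tips; have [b sb] : exists b, s = tip b.
    by case/orP: tips => /eqP; [exists true|exists false].
  have [_ VE] := ascent_start; have [_ _ _ inv] := armP b.
  have [_ _ _ inv'] := armP (~~ b).
  have -> : plin (ascent_prev k) = KLelt (arm (~~ b)) + KLelt (arm b).
    by rewrite k0 plin_ascent_prev; case: (b) => //=; rewrite addrC.
  rewrite k0 sb (VE (~~ b)).1 negbK opprD addrA; apply: rinvB.
    rewrite -[KLelt _ * C (tip b)]subr0; apply: (rinv_braid sl).
    - by rewrite tip_neq.
    - by rewrite adj_tip.
    - exact: rinv0.
    - exact: rinv0.
    - by apply: inv'; rewrite negbK eq_sym tip_neq.
  by apply: inv; rewrite tip_negb.
have [sE|sk0] := boolP ((0 < k)%N && (s == nd k)).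
  case/andP: sE => k0 /eqP sE; have [k' kE] : exists k', k = k'.+1 by exists k.-1; lia.
  rewrite sE kE in kn sp rel *; rewrite (rel k' (ltnSn _)).1 [plin (ascent_prev k'.+1)]plin_ascent_prev.
  have [_ Vinv'] := sp k' (leqnSn _).
  have finv r : (k' < r <= n)%N -> rinv (nd r) (plin (ascent_prev k')).
    move=> rn; apply: ascent_prev_inv => [|l' l'k|]; [lia|apply: sp; lia|].
    by case: eqP => k'0; [exists r => //; lia|rewrite nd_eq //; lia].
  apply: (rinv_braid sl).
  - by rewrite nd_eq //; lia.
  - by rewrite adjD_nd ?eqxx //; lia.
  - by apply: finv; lia.
  - by apply: finv; lia.
  - by apply: Vinv' => _; rewrite nd_eq //; lia.
have tips : k = 0%N -> s != tip true /\ s != tip false.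
  by move=> k0; move: notip; rewrite k0 eqxx /= negb_or => /andP.
have far : ~~ adjD s (nd k.+1).
  have [sE|[r rn sE]] := nodeD_cases s.
    rewrite sE adjD_Nnd //; apply/negP=> /eqP[k0].
    by have [_] := tips k0; rewrite sE eqxx.
  rewrite sE adjD_nd //; apply/negP=> /orP[] /eqP rE; last first.
    have rE' : r = k.+2 by lia.
    by have := sk ltac:(lia); rewrite sE rE' eqxx.
  have rE' : r = k by lia.
  have [k0|k0] := posnP k; last by move: sk0; rewrite k0 sE rE' eqxx.
  by have [+ _] := tips k0; rewrite sE rE' k0 eqxx.
apply: rinvB; first exact: (rinv_far sl far).
apply: prev_inv; case: eqP => [kE|k0].
  by have [st sf] := tips kE; apply: not_tip st sf.
by move: sk0; rewrite lt0n; case: eqP k0 => //.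
Qed.

Lemma linv_plinD s p p' : linv s (plin p) -> linv s (plin p') ->
  linv s (plin (fun y => p y + p' y)).
Proof.
move=> E E'; have -> : plin (fun y => p y + p' y) = plin p + plin p'.
  rewrite /plin linD; congr lin.
  by apply/funext=> y; rewrite rmorphD.
by rewrite /linv mulrDr scalerDr (E : C s * _ = _) (E' : C s * _ = _).
Qed.

Lemma fork_linv s d : s != nd n -> (d <= n)%N -> linv s (KLelt (U d)).
Proof.
move=> sn; elim/ltn_ind: d => -[|d] IH dn.
  by rewrite /descent /down word_nil mulg1; apply: wlinv.
have [_ -> _] := fork_rel dn; apply: linvB.
  by apply: linv_mulC; apply: IH; lia.
rewrite plin_prev_coef; case: d IH dn => [|d] IH dn; last by apply: IH; lia.
by rewrite /linv /= mulr0 scaler0.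
Qed.

Lemma arm_linv s b : s != nd n -> linv s (KLelt (arm b)).
Proof.
move=> sn; have [_ -> _ _] := armP b.
by apply: linvB; [apply: linv_mulC|]; apply: fork_linv => //; lia.
Qed.

Lemma ascent_linv s k : s != nd n -> (k <= n)%N -> linv s (KLelt (V k)).
Proof.
move=> sn; elim/ltn_ind: k => -[|k] IH kn.
  by have [_ /(_ true)[-> _]] := ascent_start; apply: linv_mulC; apply: arm_linv.
have [_ /(_ k (leqnn _))[-> _]] := ascentP kn.
apply: linvB; first by apply: linv_mulC; apply: IH; lia.
case: k IH kn => [|k] IH kn; last by apply: IH; lia.
by apply: linv_plinD; apply: arm_linv.
Qed.

Lemma fork_len d : (d <= n)%N -> len (U d) = (len w + d)%N.
Proof.
elim: d => [|d IH] dn; first by rewrite /descent /down word_nil mulg1 addn0.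
by have [_ _ ->] := fork_rel dn; rewrite IH ?addnS // ltnW.
Qed.

(** The first letter n is not a left descent.  Its step multiplies the coefficient
    by v, as n is not in the support of the element of w. *)
Lemma fork_coef d : (d <= n)%N -> KLp (U d) 1%g = 'X^(len w + d).
Proof.
elim/ltn_ind: d => -[|d] IH dn.
  by rewrite /descent /down word_nil mulg1 addn0.
have [UP hE lE] := fork_rel dn.
have asc : ~~ desc (U d) (nd (n - d)).
  by rewrite /desc -descentS lE -leqNgt ltnW.
have [d0|d0] := posnP d.
  rewrite d0 in hE asc UP *; rewrite (KLp_step sl UP asc hE).
  rewrite /= subr0 /mulC /desc length1 ltn0 mul1g IH ?d0 // addn0 addn1 exprS.
  have [->|/=] := eqVneq (KLp (U 0) (g (nd (n - 0)))) 0; first by rewrite addr0.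
  rewrite /descent /down word_nil mulg1 subn0 => /wsupp Jn.
  have : wact (g (nd n)) a = a.
    by apply: wact_parabolic Jn => s; rewrite /J /omega => /negPf->.
  by rewrite wact_gen => /(congr1 (fun f => f (nd n))); rewrite fire_self a_n.
have dlinv : linv (nd (n - d)) (KLelt (U d)).
  by apply: fork_linv; [rewrite nd_eq //; lia|lia].
have := KLp1_step sl hbar UP asc dlinv hE.
have [d' dE] : exists d', d = d'.+1 by exists d.-1; lia.
have Ed' := IH d' ltac:(lia) ltac:(lia).
rewrite (IH d) // 1?ltnW // dE /prev_coef Ed' => E.
have nzX : 'X != 0 :> {poly int} by rewrite polyX_eq0.
by apply: (mulfI nzX); rewrite E !addnS !exprS; ring.
Qed.

Lemma arm_len b : len (arm b) = (len w + n.+1)%N.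
Proof. by have [_ _ -> _] := armP b; rewrite fork_len ?addnS. Qed.

Lemma arm_coef b : KLp (arm b) 1%g = 'X^(len w + n.+1).
Proof.
have [UP _ _ _] := fork_node; have [AP hE lE _] := armP b.
have asc : ~~ desc (U n) (tip b).
  by rewrite /desc -/(arm b) lE -leqNgt ltnW.
have tlinv : linv (tip b) (KLelt (U n)).
  by apply: fork_linv => //; rewrite tip_neq // le1n leqnn.
have := KLp1_step sl hbar UP asc tlinv hE.
rewrite !fork_coef ?leq_pred // => E.
have nzX : 'X != 0 :> {poly int} by rewrite polyX_eq0.
apply: (mulfI nzX); rewrite E; move: (len w) => L.
have [k ->] : exists k, n = k.+1 by exists n.-1; lia.
by rewrite /= !addnS !exprS; ring.
Qed.

Lemma ascent_len k : (k <= n)%N -> len (V k) = (len w + n.+2 + k)%N.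
Proof.
elim: k => [|k IH] kn.
  by have [_ /(_ true)[_ ->]] := ascent_start; rewrite arm_len; lia.
by have [_ /(_ k (leqnn _))[_ ->]] := ascentP kn; rewrite IH ?addnS // ltnW.
Qed.

(** Up to a common factor, both v^k and v^-k solve the recursion of KLp1_step, and
    the coefficients of the two arms add up to the value of their sum one step
    before V 0. *)
Lemma ascent_coef k : (k < n)%N ->
  KLp (V k) 1%g = 'X^(len w + n.+2 + k) + 'X^(len w + n - k).
Proof.
have nzX : 'X != 0 :> {poly int} by rewrite polyX_eq0.
elim/ltn_ind: k => -[|k] IH kn.
  have [_ /(_ true)[VE VL]] := ascent_start; have [AP _ _ _] := armP true.
  have asc : ~~ desc (arm true) (tip false).
    by rewrite /desc -(ascent0 true) VL -leqNgt ltnW.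
  have hE : KLelt (V 0) = KLelt (arm true) * C (tip false) - plin (fun=> 0).
    rewrite VE [plin _](_ : _ = 0) ?subr0 // /plin /lin big1 // => y _.
    by rewrite rmorph0 scale0r.
  have tlinv : linv (tip false) (KLelt (arm true)).
    by apply: arm_linv; rewrite tip_neq // le1n leqnn.
  have := KLp1_step sl hbar AP asc tlinv hE.
  rewrite arm_coef => E; apply: (mulfI nzX); rewrite E addn0 subn0 !addnS !exprS.
  by ring.
have [sp rel] := ascentP (ltnW kn); have [hE lE] := rel k (leqnn _).
have [VP _] := sp k (leqnSn _).
have asc : ~~ desc (V k) (nd k.+1).
  by rewrite /desc -ascentS lE -leqNgt ltnW.
have tlinv : linv (nd k.+1) (KLelt (V k)).
  by apply: ascent_linv; [rewrite nd_eq //; lia|lia].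
have := KLp1_step sl hbar VP asc tlinv hE.
rewrite (IH k) // 1?ltnW // => E; apply: (mulfI nzX); rewrite E.
case: k IH kn {E hE lE VP asc tlinv sp rel} => [|k] IH kn.
  rewrite /= !arm_coef; have [r rE] : exists r, (len w + n)%N = r.+1.
    by exists (len w + n).-1; lia.
  by rewrite !addnS rE subn0 subn1 addn0 /= !exprS; ring.
rewrite /= (IH k) // 1?ltnW //; last by lia.
have [r rE] : exists r, (len w + n - k.+2)%N = r by exists (len w + n - k.+2)%N.
have -> : (len w + n - k.+1 = r.+1)%N by lia.
have -> : (len w + n - k = r.+2)%N by lia.
by rewrite rE !addnS !exprS; ring.
Qed.

(** The last element of the chain is w_0 as it has no ascent, so the others are
    obtained from w_0 by going back. *)
Lemma end_row_from_parabolic i : (0 < i <= n)%N ->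
  let x := (longest W * word (down (n - i).+1))%g in
  [/\ hasKL x, forall s, s != nd i -> rinv s (KLelt x),
     forall s, s != nd n -> linv s (KLelt x),
     KLp x 1%g = 'X^(len w + n.+1 + i) + 'X^(len w + n.+1 - i) &
     len x = (len w + n.+1 + i)%N].
Proof.
move=> iP x.
have V_longest : V n = longest W.
  apply: (longest_uniq m_diag) => s.
  have [VP Vinv] := (ascentP (leqnn n)).1 n (leqnn n).
  apply: (KL_desc sl VP).
  by apply: Vinv; rewrite ltnn.
have VE d : (d <= n)%N -> (longest W * word (down d))%g = V (n - d).
  elim: d => [|d IH] dn; first by rewrite /down word_nil mulg1 subn0 V_longest.
  rewrite word_down mulgA IH; last by lia.
  have -> : (n - d = (n - d.+1).+1)%N by lia.
  by rewrite ascentS genK //; apply: m_diag.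
have xE : x = V i.-1.
  by rewrite /x VE; [congr V; lia|lia].
have [sp _] := ascentP (leqnn n); have [VP Vinv] := sp i.-1 ltac:(lia).
rewrite xE; split=> //.
- by move=> s si; apply: Vinv => _; rewrite prednK //; lia.
- by move=> s sn; apply: ascent_linv => //; lia.
- by rewrite ascent_coef; [congr ('X^_ + 'X^_); lia|lia].
- by rewrite ascent_len; lia.
Qed.

End Fork.

(** ** The elements w_0 n ... i *)

Local Notation w0 := (longest W).

Lemma end_row : exists2 L, (n < L)%N & forall i, (0 < i <= n)%N ->
  let x := (w0 * word (down (n - i).+1))%g in
  [/\ hasKL x, forall s, s != nd i -> rinv s (KLelt x),
     forall s, s != nd n -> linv s (KLelt x),
     KLp x 1%g = 'X^(L + i) + 'X^(L - i) & len x = (L + i)%N].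
Proof.
have [w [p [Jw pP inv p1 supp]]] := KL_parabolic sl W hbar (fun s => s != nd n).
have [wP wE] := hasKL_coefs sl hbar pP.
exists (len w + n.+1)%N; first by lia.
by apply: (end_row_from_parabolic (w := w)) => //; rewrite ?/KLelt ?wE // => s /inv[].
Qed.

(** ** Conjugation by the longest element *)

Lemma longest_sqr : (w0 * w0 = 1)%g.
Proof. by rewrite -{2}(longestV m_diag) mulgV. Qed.

Lemma longest_gen s t : ~~ desc (w0 * g s)^-1%g t -> (g s * w0 = w0 * g t)%g.
Proof.
move=> xt; have lx := length_desc m_diag (desc_longest m_diag W s).
have /(length_longest_uniq m_diag) : len ((w0 * g s)^-1 * g t)%g = len w0.
  by rewrite (length_asc m_diag xt) (lengthV m_diag).
rewrite invMg (cox_genV m_diag) (longestV m_diag) => E.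
by rewrite -{2}E genK //; apply: m_diag.
Qed.

Lemma longest_conj s : exists t, (g s * w0 = w0 * g t)%g.
Proof.
have [[t xt]|no] := pselect (exists t, ~~ desc (w0 * g s)^-1%g t).
  by exists t; apply: longest_gen.
have /(congr1 len) : (w0 * g s)^-1%g = w0.
  apply: (longest_uniq m_diag) => t; apply: contraT => xt.
  by case: no; exists t.
rewrite (lengthV m_diag).
by have := length_desc m_diag (desc_longest m_diag W s); lia.
Qed.

(** Conjugation by w_0 is an automorphism of the diagram.  It fixes the end n, the
    only left ascent of w_0 n, and then each neighbour along the arm. *)
Lemma longest_comm k : (0 < k <= n)%N -> (g (nd k) * w0 = w0 * g (nd k))%g.
Proof.
have [L _ /(_ n)] := end_row; rewrite leqnn (ltnW n_ge2) subnn => /(_ isT).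
rewrite word_down /down word_nil mul1g subn0 => -[xP _ xlinv _ _].
have base : (g (nd n) * w0 = w0 * g (nd n))%g.
  apply: longest_gen; apply/negP=> xn.
  have /(congr1 len) : (w0 * g (nd n))^-1%g = w0.
    apply: (longest_uniq m_diag) => s.
    have [->//|sn] := eqVneq s (nd n).
    apply: (KL_ldesc sl hbar xP).
    exact: xlinv.
  rewrite (lengthV m_diag).
  by have := length_desc m_diag (desc_longest m_diag W (nd n)); lia.
move=> kP; have [d kE] : exists d, k = (n - d)%N by exists (n - k)%N; lia.
move: kP; rewrite kE {k kE}; elim/ltn_ind: d => -[|d] IH dn; first by rewrite subn0.
have kn : (0 < n - d <= n)%N by lia.
have IHd := IH d (ltnSn _) kn.
have [t tE] := longest_conj (nd (n - d.+1)).
have ginj := gen_inj sl (W := W).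
have neq : t != nd (n - d).
  apply/eqP=> tE'; move: tE; rewrite tE' -IHd => /mulIg/ginj/eqP.
  by rewrite nd_eq; lia.
have adj : adjD t (nd (n - d)).
  rewrite -[adjD _ _]negbK -(gen_commP sl W) //.
  apply/negP=> /eqP comm.
  have : (g (nd (n - d.+1)) * g (nd (n - d)) == g (nd (n - d)) * g (nd (n - d.+1)))%g.
    apply/eqP; apply: (mulIg w0).
    by rewrite -!mulgA IHd tE !mulgA tE IHd -!mulgA comm.
  rewrite (gen_commP sl).
    by rewrite adjD_nd //; lia.
  by rewrite nd_eq //; lia.
suff tS : t = nd (n - d.+1) by rewrite tE tS.
have [tN|[l ln tl]] := nodeD_cases t.
  by move: adj; rewrite tN adjD_Nnd; [move=> /eqP; lia|lia].
move: adj; rewrite tl adjD_nd //; last by lia.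
case/orP=> /eqP lE; first by congr nd; lia.
have := IH d.-1 ltac:(lia) ltac:(lia); have -> : (n - d.-1 = l)%N by lia.
rewrite -tl => tcomm; move: tE; rewrite -tcomm => /mulIg/ginj/eqP.
by rewrite tl nd_eq //; lia.
Qed.

Lemma longest_word u : all (fun s => (s != nd 0) && (s != None)) u ->
  (word u * w0 = w0 * word u)%g.
Proof.
elim: u => [|s u IH] /=; first by rewrite word_nil mulg1 mul1g.
case/andP=> /andP[s0 sN] /IH{}IH; rewrite word_cons -mulgA IH !mulgA.
have [sE|[l ln sE]] := nodeD_cases s; first by rewrite sE in sN.
rewrite sE longest_comm //; case: l ln sE => // ln sE.
by rewrite sE eqxx in s0.
Qed.

Lemma seg_cat i d d' : seg i (d + d') = seg i d ++ seg (i + d) d'.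
Proof.
have shift : iota d d' = [seq (d + l)%N | l <- iota 0 d'] by rewrite -iotaDl addn0.
rewrite /seg iotaD map_cat add0n shift -map_comp.
by congr (_ ++ _); apply: eq_map => l /=; rewrite addnA.
Qed.

Lemma down_seg d : (d <= n)%N -> down d = rev (seg (n - d).+1 d).
Proof.
move=> dn; apply: (@eq_from_nth _ None); first by rewrite size_rev !size_map !size_iota.
move=> l; rewrite size_map size_iota => ld.
rewrite nth_rev; last by rewrite size_map size_iota.
rewrite /down /seg size_map size_iota !(nth_map 0%N) ?size_iota //; last by lia.
by rewrite !nth_iota //; [congr nd|]; lia.
Qed.

Lemma seg_pos i d : (0 < i)%N -> (i + d <= n.+1)%N ->
  all (fun s => (s != nd 0) && (s != None)) (seg i d).
Proof.
move=> i0 idn; apply/allP=> s /mapP[l]; rewrite mem_iota => ld ->.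
by rewrite nd_eq; [rewrite andbT; lia|lia|].
Qed.

(** Conjugation by w_0 fixes i and permutes the other nodes, so the image of the
    weight of i is invariant under those.  Its coordinate at i is at most 0 by
    desc_longest, and not 0 since w_0 is an involution. *)
Lemma longest_weight i : (0 < i <= n)%N ->
  wact w0 (omega i) (nd i) < 0 /\ forall s, s != nd i -> wact w0 (omega i) s = 0.
Proof.
move=> iP; set b := wact w0 (omega i).
have b0 s : s != nd i -> b s = 0.
  move=> si; have [t tE] := longest_conj s.
  have tE' : (g t * w0 = w0 * g s)%g.
    apply: (mulgI w0); apply: (mulIg w0).
    by rewrite -!mulgA longest_sqr mulg1 tE !mulgA longest_sqr mul1g.
  have ti : t != nd i.
    apply: contraNneq si => ti; move: tE'; rewrite ti longest_comm // => /mulgI E.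
    by rewrite (gen_inj sl E).
  have : wact (g t * w0)%g (omega i) = b.
    by rewrite wactM wact_gen fire_id //; rewrite /omega (negPf ti).
  rewrite tE' wactS => /(congr1 (fun f => f s)); rewrite fire_self -/b.
  lia.
split=> //; rewrite lt_neqAle; apply/andP; split; last first.
  apply: (wact_desc sl (omega_ge0 i)).
  exact: desc_longest m_diag W _.
apply/eqP=> bi.
have b0' s : b s = 0 by have [->|/b0] := eqVneq s (nd i).
have : wact w0 b = b.
  apply: (@wact_parabolic predT) => [s _|]; first exact: b0'.
  apply/parabolicP; exists (reduced_word w0); first exact: all_predT.
  exact: reduced_wordE.
rewrite /b -wactM longest_sqr wact1 => /(congr1 (fun f => f (nd i))).
by rewrite -/b bi /omega eqxx.
Qed.

Lemma seg_weight i d : (0 < i)%N -> (i + d <= n)%N ->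
  forall k, (i <= k <= n)%N -> wact (w0 * word (seg i d.+1))%g (omega i) (nd k) =
    if k == (i + d)%N then - wact w0 (omega i) (nd i)
    else if k == (i + d).+1 then wact w0 (omega i) (nd i) else 0.
Proof.
move=> i0; elim: d => [|d IH] idn k kn; rewrite word_seg mulgA wactS.
  have [wi wk] := longest_weight (i := i) ltac:(lia).
  rewrite /seg word_nil mulg1 !addn0 fire_nd; [|lia|lia].
  have [ki|ki] := eqVneq k i; first by [].
  rewrite (wk (nd k)); last by rewrite nd_eq //; lia.
  rewrite add0r eq_sym; have [ki'|ki'] := eqVneq k i.+1; first by [].
  by rewrite ifN //=; lia.
have idn' : (i + d <= n)%N by lia.
have IHk := IH idn'.
have wj : wact (w0 * word (seg i d.+1))%g (omega i) (nd (i + d.+1)) =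
    wact w0 (omega i) (nd i).
  rewrite IHk; last by lia.
  rewrite ifN; last by lia.
  by rewrite ifT //; lia.
rewrite fire_nd; [|lia|lia].
rewrite wj (IHk k) // addnS.
have [kE|k1] := eqVneq k (i + d).+1; first by [].
have [kE|k2] := eqVneq k (i + d)%N.
  rewrite ifT; last by lia.
  by rewrite addNr ifN //; lia.
have [kE|k3] := eqVneq k (i + d).+2; first by rewrite add0r.
by rewrite ifN //=; lia.
Qed.

(** ** The chain from w_in to w_ij *)

Definition ladder A d : {poly int} := \sum_(0 <= r < d.+1) 'X^(A + d - 2 * r).

(* The bound keeps the subtractions in the exponents from truncating. *)
Lemma ladderS A d : (d < A)%N -> 'X * ladder A d.+1 = 'X^((A + d).+2) + ladder A d.
Proof.
move=> dA; rewrite /ladder big_nat_recl // mulrDr muln0 subn0 -exprS addnS.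
congr (_ + _); rewrite mulr_sumr; apply: eq_big_nat => r rd.
by rewrite -exprS; congr ('X^_); lia.
Qed.

Lemma ladder0 A : ladder A 0 = 'X^A.
Proof. by rewrite /ladder big_nat1 muln0 subn0 addn0. Qed.

Lemma ladder_rec A d : (d.+1 < A)%N ->
  'X * ladder A d.+2 = ('X^2 + 1) * ladder A d.+1 - 'X * ladder A d.
Proof.
move=> dA; rewrite ladderS // mulrDl mul1r expr2 -mulrA (@ladderS A d); last by lia.
by rewrite mulrDr -exprS addnS [RHS]addrAC addrK.
Qed.

(** Here x is w_in, with the data obtained for its inverse w_ni. *)
Section Row.
Variables (L i : nat) (x : W).
Hypotheses (nL : (n < L)%N) (iP : (0 < i <= n)%N).
Hypothesis xE : x = (word (seg i (n - i).+1) * w0)%g.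
Hypotheses (xP : hasKL x) (xinv : forall s, s != nd n -> rinv s (KLelt x)).
Hypothesis xlinv : forall s, s != nd i -> linv s (KLelt x).
Hypothesis x1 : KLp x 1%g = 'X^(L + i) + 'X^(L - i).
Hypothesis xlen : len x = (L + i)%N.
Local Notation U := (descent x).

Lemma row_KL d : (d <= n - i)%N ->
  [/\ hasKL (U d), KLp (U d) 1%g = ladder (L + i) d + ladder (L - i) d &
    len (U d) = (L + i + d)%N].
Proof.
have wE k : (i <= k <= n)%N -> wact x (omega i) (nd k) =
    if k == n then - wact w0 (omega i) (nd i) else 0.
  move=> kn; rewrite xE longest_word; last by apply: seg_pos; lia.
  rewrite seg_weight //; [|lia|lia].
  have -> : (i + (n - i))%N = n by lia.
  by case: eqP => // _; rewrite ifN //; lia.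
have [wi _] := longest_weight iP.
have wn : 0 < wact x (omega i) (nd n) by rewrite wE ?eqxx; lia.
have wk k : (i <= k < n)%N -> wact x (omega i) (nd k) = 0.
  by move=> kn; rewrite wE ?ifN //; lia.
have i0 : (0 < i)%N by lia.
have i_n : (i <= n)%N by lia.
have [sp rel] := descentP i0 i_n xP xinv (omega_ge0 i) wn wk (leqnn (n - i)).
have lin s d' := descent_linv i0 i_n xP xinv (omega_ge0 i) wn wk (s := s) (d := d').
elim/ltn_ind: d => -[|d] IH dn.
  rewrite !ladder0 /descent /down word_nil mulg1 addn0.
  by split.
have [hE lE] := rel d dn; have [UP _] := sp d (ltnW dn).
have [_ Ud1 Udl] := IH d (leqnn _) (ltnW dn).
split; [exact: (sp d.+1 dn).1| |by rewrite lE Udl addnS].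
have asc : ~~ desc (U d) (nd (n - d)).
  by rewrite /desc -descentS lE -leqNgt ltnW.
have hE' : KLelt (U d.+1) = KLelt (U d) * C (nd (n - d)) - plin (prev_coef x d).
  by rewrite plin_prev_coef.
have dlinv : linv (nd (n - d)) (KLelt (U d)).
  by apply: lin; [apply: xlinv; rewrite nd_eq //; lia|lia].
have := KLp1_step sl hbar UP asc dlinv hE'.
rewrite Ud1; have nzX : 'X != 0 :> {poly int} by rewrite polyX_eq0.
move=> E; apply: (mulfI nzX); rewrite E.
case: d IH dn {hE lE UP Ud1 Udl asc hE' dlinv E} => [|d] IH dn.
  rewrite /= mulr0 subr0 [RHS]mulrDr !ladderS; [|lia|lia].
  by rewrite !ladder0 !addn0 !exprS; ring.
rewrite /=; have [_ -> _] := IH d ltac:(lia) ltac:(lia).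
rewrite [RHS]mulrDr !ladder_rec; [|lia|lia].
by ring.
Qed.

End Row.

End TypeD.

(** * Geodesics of the diagram *)

Lemma map_iotaSr (A : Type) (f : nat -> A) d :
  [seq f l | l <- iota 0 d.+1] = rcons [seq f l | l <- iota 0 d] (f d).
Proof. by rewrite -addn1 iotaD map_cat cats1. Qed.

Section MonotonePaths.
Variables (T : eqType) (e : rel T) (h : T -> nat) (nd : nat -> T).
Hypothesis h_step : forall s t, e s t -> h t = (h s).+1 \/ h s = (h t).+1.
Hypothesis h_inv : forall s, (0 < h s)%N -> s = nd (h s).

Lemma path_height s p : path e s p ->
  (h (last s p) <= h s + size p)%N /\ (h s <= h (last s p) + size p)%N.
Proof.
elim: p s => [|t p IH] s /=; first by rewrite addn0.
by case/andP=> /h_step st /IH[]; lia.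
Qed.

(** The equality of lengths forces each step to go up, and a node of positive
    height is determined by its height. *)
Lemma path_up s p : path e s p -> h (last s p) = (h s + size p)%N ->
  p = [seq nd (h s + l.+1) | l <- iota 0 (size p)].
Proof.
elim: p s => [|t p IH] s //= /andP[st tp] hE.
have [lt _] := path_height tp; have ht : h t = (h s).+1.
  by case: (h_step st) => hst //; move: lt; rewrite hE; lia.
rewrite {1}(h_inv (s := t)) ?ht // addn1; congr (_ :: _).
rewrite {1}(IH t tp); last by rewrite hE ht; lia.
rewrite ht -[1%N]addn0 iotaDl -map_comp.
by apply: eq_map => l /=; congr nd; lia.
Qed.

Lemma path_down s p : path e s p -> (0 < h (last s p))%N ->
  h s = (h (last s p) + size p)%N ->
  p = [seq nd (h s - l.+1) | l <- iota 0 (size p)].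
Proof.
elim: p s => [|t p IH] s //= /andP[st tp] h0 hE.
have [_ lt] := path_height tp; have ht : h s = (h t).+1.
  by case: (h_step st) => hst //; move: lt; rewrite -?hst; lia.
have ht0 : (0 < h t)%N by lia.
rewrite {1}(h_inv ht0) ht subn1 /=; congr (_ :: _).
rewrite {1}(IH t tp) //; last by lia.
rewrite -[1%N]addn0 iotaDl -map_comp; apply: eq_map => l /=; congr nd; lia.
Qed.

Lemma shortest_up s t p : path e s p -> last s p = t -> h t = (h s + size p)%N ->
  is_shortest_path e s t p /\ forall r, is_shortest_path e s t r -> r = p.
Proof.
move=> pP pt hE; have min r : path e s r -> last s r = t -> (size p <= size r)%N.
  by move=> rP rt; have [] := path_height rP; rewrite rt; lia.
split=> // r [rP rt rmin]; have szr : size r = size p.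
  by have := rmin p pP pt; have := min r rP rt; lia.
have rE := path_up rP; have pE := path_up pP; rewrite rt szr in rE; rewrite pt in pE.
exact: etrans (rE hE) (esym (pE hE)).
Qed.

Lemma shortest_down s t p : path e s p -> last s p = t -> (0 < h t)%N ->
  h s = (h t + size p)%N ->
  is_shortest_path e s t p /\ forall r, is_shortest_path e s t r -> r = p.
Proof.
move=> pP pt h0 hE; have min r : path e s r -> last s r = t -> (size p <= size r)%N.
  by move=> rP rt; have [] := path_height rP; rewrite rt; lia.
split=> // r [rP rt rmin]; have szr : size r = size p.
  by have := rmin p pP pt; have := min r rP rt; lia.
have rE := path_down rP; have pE := path_down pP.
rewrite rt szr in rE; rewrite pt in pE.
exact: etrans (rE h0 hE) (esym (pE h0 hE)).
Qed.

End MonotonePaths.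

Section Geodesics.
Variable n : nat.
Implicit Types (s t : nodeD n) (p : seq (nodeD n)).
Local Notation nd := (@nd n).

(** The distance to the pair of nodes 0^+ and 0^-. *)
Definition height s : nat := if s is Some k then k else 0.

Lemma height_nd k : (k <= n)%N -> height (nd k) = k.
Proof. by move=> kn; rewrite /= inordK. Qed.

Lemma height_adj s t : adjD s t ->
  height t = (height s).+1 \/ height s = (height t).+1.
Proof. by case: s t => [a|] [b|] //=; lia. Qed.

Lemma height_inv s : (0 < height s)%N -> s = nd (height s).
Proof. by case: s => [a|//] _; rewrite -nd_val. Qed.

Lemma geodesic_up i d : (0 < i)%N -> (i + d <= n)%N ->
  geodesicD (nd i) (nd (i + d)) = [seq nd (i + l.+1) | l <- iota 0 d].
Proof.
move=> i0 idn; set p := [seq _ | _ <- _].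
have szp : size p = d by rewrite size_map size_iota.
have pP : path (@adjD n) (nd i) p /\ last (nd i) p = nd (i + d).
  rewrite /p; elim: d idn {p szp} => [|d IH] idn; first by rewrite addn0.
  have [IH1 IH2] := IH ltac:(lia).
  rewrite map_iotaSr rcons_path last_rcons IH1 IH2 adjD_nd; [|lia|lia].
  by rewrite addnS eqxx.
have [pg puniq] : is_shortest_path (@adjD n) (nd i) (nd (i + d)) p /\
    forall r, is_shortest_path (@adjD n) (nd i) (nd (i + d)) r -> r = p.
  apply: (shortest_up height_adj height_inv); [exact: pP.1|exact: pP.2|].
  by rewrite szp !height_nd //; lia.
exact: xget_unique pg puniq.
Qed.

Lemma geodesic_down i d : (0 < i)%N -> (i + d <= n)%N ->
  geodesicD (nd (i + d)) (nd i) = [seq nd (i + d - l.+1) | l <- iota 0 d].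
Proof.
move=> i0 idn; set p := [seq _ | _ <- _].
have szp : size p = d by rewrite size_map size_iota.
have pP k : (k <= d)%N -> let q := [seq nd (i + d - l.+1) | l <- iota 0 k] in
    path (@adjD n) (nd (i + d)) q /\ last (nd (i + d)) q = nd (i + d - k).
  elim: k => [|k IH] kd; first by rewrite subn0.
  have [IH1 IH2] := IH ltac:(lia).
  move=> q; rewrite /q map_iotaSr rcons_path last_rcons IH1 IH2 adjD_nd; [|lia|lia].
  by split=> //; apply/orP; right; lia.
have {}pP := pP d (leqnn d); rewrite addnK in pP.
have [pg puniq] : is_shortest_path (@adjD n) (nd (i + d)) (nd i) p /\
    forall r, is_shortest_path (@adjD n) (nd (i + d)) (nd i) r -> r = p.
  apply: (shortest_down height_adj height_inv); [exact: pP.1|exact: pP.2| |].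
    by rewrite height_nd //; lia.
  by rewrite szp !height_nd //; lia.
exact: xget_unique pg puniq.
Qed.

Lemma hat_nd k : (0 < k <= n)%N -> hatD (nd k) = nd k.
Proof.
move=> kn; rewrite /hatD; case: odd => //; rewrite tpermD //.
have -> : Some ord0 = nd 0 by rewrite [LHS]nd_val.
by rewrite nd_eq //; lia.
Qed.

End Geodesics.

(** * Kazhdan-Lusztig polynomials of the penultimate cell *)

Local Open Scope ring_scope.

Theorem proposition5p29 (n : nat) (hn : (2 <= n)%N)
    (W : coxeter_system (@coxD n)) (H : hecke_algebra (@coxD n))
    (bar : {rmorphism H -> H}) (hbar : is_bar bar)
    (i j : 'I_n.+1) (hi : (1 <= i)%N) (hij : (i <= j)%N) :
  let y : W := w_D W (Some i) (Some j) in
  let l := cox_length y in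
  let P : {poly int} :=
    \sum_(0 <= k < (n - j).+1) 'X^(l - 2 * k) +
    \sum_(0 <= k < (n - j).+1) 'X^(l - 2 * i - 2 * k) in
  KL_poly bar 1%g (w_D W (Some i) (Some j)) = P /\
  KL_poly bar 1%g (w_D W (Some j) (Some i)) = P.
Proof.
have sl := coxD_simply_laced n; have m_diag := sl_diag sl.
have jn : (j <= n)%N by rewrite -ltnS.
have [L nL sum] := end_row hn W hbar.
have iP : (0 < i <= n)%N by lia.
pose u := seg n i (j - i).+1; pose u' := seg n j.+1 (n - j).
have uu : seg n i (n - i).+1 = u ++ u'.
  rewrite /u /u' (_ : (n - i).+1 = (j - i).+1 + (n - j))%N; last by lia.
  by rewrite seg_cat; congr (_ ++ seg n _ _); lia.
have u_pos : all (fun s => (s != nd n 0) && (s != None)) u.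
  by apply: seg_pos; lia.
have yE : w_D W (Some i) (Some j) = (word_prod W u * longest W)%g.
  rewrite /w_D /s_D !nd_val hat_nd; last by lia.
  rewrite [geodesicD _ _](_ : _ = [seq nd n (i + l.+1) | l <- iota 0 (j - i)]); last first.
    by rewrite -geodesic_up ?subnKC //; lia.
  congr (word_prod W _ * _)%g; rewrite /u /seg /= addn0; congr (_ :: _).
  by rewrite -[1%N]addn0 iotaDl -map_comp; apply: eq_map.
have yE' : w_D W (Some j) (Some i) = (word_prod W (rev u) * longest W)%g.
  rewrite /w_D /s_D !nd_val hat_nd; last by lia.
  rewrite [geodesicD _ _](_ : _ = [seq nd n (j - l.+1) | l <- iota 0 (j - i)]); last first.
    by have := @geodesic_down n i (j - i) hi; rewrite subnKC // => ->.
  congr (word_prod W _ * _)%g; apply: (@eq_from_nth _ None).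
    by rewrite size_rev /= !size_map !size_iota.
  rewrite /= size_map size_iota => k kd; rewrite nth_rev ?size_map ?size_iota //.
  rewrite (nth_map 0%N) ?size_iota; last by lia.
  rewrite nth_iota; last by lia.
  case: k kd => [|k] kd /=; first by congr nd; lia.
  rewrite (nth_map 0%N) ?size_iota // nth_iota //; congr nd; lia.
have yV : w_D W (Some j) (Some i) = (w_D W (Some i) (Some j))^-1%g.
  rewrite yE yE' (word_rev m_diag).
  rewrite invMg (longestV m_diag) -(word_rev m_diag).
  by rewrite (longest_word hn W hbar) // all_rev.
(* This is w_in, written as the inverse of w_ni. *)
pose x := (longest W * word_prod W (down n (n - i).+1))^-1%g.
have [xP xinv xlinv x1 xlen] := sum i iP.
have [xP' xinv' xlinv'] := KL_coefsV sl hbar xP.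
have [x'P KLE] := hasKL_coefs sl hbar xP'.
have xE : x = (word_prod W (seg n i (n - i).+1) * longest W)%g.
  rewrite /x invMg (longestV m_diag) -(word_rev m_diag) (down_seg hn); last by lia.
  by rewrite revK (_ : (n - (n - i).+1).+1 = i)%N //; lia.
have dn : (n - j <= n - i)%N by lia.
have [UP U1 Ul] : [/\ hasKL (W := W) bar (descent x (n - j)),
    KLp bar (descent x (n - j)) 1%g = ladder (L + i) (n - j) + ladder (L - i) (n - j)
    & cox_length (descent x (n - j)) = (L + i + (n - j))%N].
  apply: (row_KL hn hbar nL iP xE) => //.
  - by move=> s sn; rewrite /KLelt KLE; apply: xlinv'; apply: xlinv.
  - by move=> s sn; rewrite /KLelt KLE; apply: xinv'; apply: xinv.
  - by rewrite KLE invg1.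
  - by rewrite (lengthV m_diag).
have UE : descent x (n - j) = w_D W (Some i) (Some j).
  rewrite /descent xE uu word_cat yE (down_seg hn); last by lia.
  rewrite (_ : (n - (n - j)).+1 = j.+1)%N; last by lia.
  rewrite (word_rev m_diag) -/u' -!mulgA; congr (_ * _)%g.
  have /(longest_word hn W hbar) E : all (fun s => (s != nd n 0) && (s != None)) u'.
    by apply: seg_pos; lia.
  by rewrite mulgA E mulgK.
move=> y l P; rewrite UE in UP U1 Ul.
have PE : KLp bar (w_D W (Some i) (Some j)) 1%g = P.
  rewrite U1 /P /l /y Ul /ladder; congr (_ + _); apply: eq_big_nat => r rn.
    by congr ('X^_); lia.
split; first exact: PE.
have [yP _ _] := KL_coefsV sl hbar UP.
have [_ E] := hasKL_coefs sl hbar yP.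
by rewrite yV -[KL_poly bar _ _]/(KLp bar _ 1%g) E invg1.
Qed.
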